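(* Let $n$ be a positive, even, squarefree integer such that $n = u^2 + v^2$ for some integers $u, v$. Then every form $g$ in the same spinor genus as the ternary quadratic form $\langle 1,1,16n,0,0,0\rangle$, i.e. $x^2 + y^2 + 16 n z^2$, also integrally represents $n$; that is, there exist integers $x,y,z$ with $g(x,y,z) = n$.
   Context: The integer sextuple $\langle a,b,c,r,s,t\rangle$ denotes the ternary quadratic form $f(x,y,z) = a x^2 + b y^2 + c z^2 + r yz + s zx + t xy$. All forms considered are positive definite with integer coefficients $a,b,c,r,s,t$ and primitive ($\gcd(a,b,c,r,s,t)=1$). Spinor genus has its standard meaning: identify a form with a $\mathbf{Z}$-lattice $L$ in a quadratic space $V$ over $\mathbf{Q}$. A lattice $M$ on $V$ is in the spinor genus of $L$ if there are $\sigma \in O(V)$ and, for every prime $p$, an element $\Sigma_p \in O'(V_p)$ (the kernel of the spinor norm on $SO(V_p)$, where $V_p = V \otimes \mathbf{Q}_p$) such that $M_p = \sigma \Sigma_p L_p$ for every prime $p$. A form is in the spinor genus of a given form if it is integrally equivalent to the form of such a lattice $M$. *)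

(* Defs.v *)
From HB Require Import structures.
From mathcomp Require Import all_boot all_order all_algebra.
From mathcomp Require Import boolp classical_sets.
Set Implicit Arguments.
Unset Strict Implicit.
Unset Printing Implicit Defensive.
Import GRing.Theory Num.Theory.
Local Open Scope ring_scope.

Definition prime_number := {p : nat | prime p}.

(** The ring Z_p, as the inverse limit of the rings Z/p^k: an element is the
    sequence of its residues modulo p^k, each normalised to lie in [0, p^k). *)

Section PadicIntegers.
Variable p : prime_number.

Local Notation P k := (((val p) ^ k)%N%:Z).

Record padic_int := PadicInt {
  residue : nat -> int;
  residueP : forall k, residue k = (residue k.+1 %% P k)%Z }.

HB.instance Definition _ := gen_eqMixin padic_int.
HB.instance Definition _ := gen_choiceMixin padic_int.

Lemma padic_int_eq (x y : padic_int) : residue x =1 residue y -> x = y.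
Proof.
case: x y => [x hx] [y hy] /= /funext exy; move: hx hy; rewrite {}exy => hx hy.
by congr PadicInt; exact: Prop_irrelevance.
Qed.

Lemma residue_small (x : padic_int) k : (residue x k %% P k)%Z = residue x k.
Proof. by rewrite residueP modz_mod. Qed.

Lemma dvd_expSP k : (P k %| P k.+1)%Z.
Proof. by rewrite dvdzE /= dvdn_exp2l. Qed.

Lemma residueS (x : padic_int) k :
  (residue x k.+1 = residue x k %[mod P k])%Z.
Proof. by rewrite residue_small -residueP. Qed.

Lemma padic_lim_subproof (u : nat -> int) :
  (forall k, (u k.+1 = u k %[mod P k])%Z) ->
  forall k, (u k %% P k)%Z = ((u k.+1 %% P k.+1)%Z %% P k)%Z.
Proof.
move=> hu k; rewrite -hu; apply/eqP; rewrite eqz_mod_dvd.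
apply: (dvdz_trans (dvd_expSP k)).
by rewrite -eqz_mod_dvd modz_mod.
Qed.

Definition padic_lim u hu := PadicInt (@padic_lim_subproof u hu).

Lemma padic_int_const_subproof (m : int) k : (m = m %[mod P k])%Z.
Proof. by []. Qed.

Lemma padic_opp_subproof x k :
  (- residue x k.+1 = - residue x k %[mod P k])%Z.
Proof. by rewrite -modzNm residueS modzNm. Qed.

Lemma padic_add_subproof x y k :
  (residue x k.+1 + residue y k.+1 = residue x k + residue y k %[mod P k])%Z.
Proof. by rewrite -modzDm !residueS modzDm. Qed.

Lemma padic_mul_subproof x y k :
  (residue x k.+1 * residue y k.+1 = residue x k * residue y k %[mod P k])%Z.
Proof. by rewrite -modzMm !residueS modzMm. Qed.

Definition padic_const m :=
  @padic_lim (fun=> m) (padic_int_const_subproof m).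
Definition padic_opp x := padic_lim (padic_opp_subproof x).
Definition padic_add x y := padic_lim (padic_add_subproof x y).
Definition padic_mul x y := padic_lim (padic_mul_subproof x y).

Lemma padic_addA : associative padic_add.
Proof.
by move=> x y z; apply: padic_int_eq => k /=; rewrite modzDml modzDmr addrA.
Qed.

Lemma padic_addC : commutative padic_add.
Proof. by move=> x y; apply: padic_int_eq => k /=; rewrite addrC. Qed.

Lemma padic_add0 : left_id (padic_const 0) padic_add.
Proof.
by move=> x; apply: padic_int_eq => k /=; rewrite modzDml add0r residue_small.
Qed.

Lemma padic_addN : left_inverse (padic_const 0) padic_opp padic_add.
Proof.
by move=> x; apply: padic_int_eq => k /=; rewrite modzDml addNr.
Qed.

HB.instance Definition _ :=
  GRing.isZmodule.Build padic_int padic_addA padic_addC padic_add0 padic_addN.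

Lemma padic_mulA : associative padic_mul.
Proof.
by move=> x y z; apply: padic_int_eq => k /=; rewrite modzMml modzMmr mulrA.
Qed.

Lemma padic_mulC : commutative padic_mul.
Proof. by move=> x y; apply: padic_int_eq => k /=; rewrite mulrC. Qed.

Lemma padic_mul1 : left_id (padic_const 1) padic_mul.
Proof.
by move=> x; apply: padic_int_eq => k /=; rewrite modzMml mul1r residue_small.
Qed.

Lemma padic_mulD : left_distributive padic_mul padic_add.
Proof.
move=> x y z; apply: padic_int_eq => k /=.
by rewrite modzMml modzDm mulrDl.
Qed.

Lemma padic_oner_neq0 : padic_const 1 != padic_const 0.
Proof.
apply/eqP => /(congr1 (fun x => residue x 1)) /=.
by rewrite !modz_nat expn1 mod0n modn_small // prime_gt1 // (valP p).
Qed.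

HB.instance Definition _ := GRing.Zmodule_isComNzRing.Build padic_int
  padic_mulA padic_mulC padic_mul1 padic_mulD padic_oner_neq0.

Definition padic_unit : {pred padic_int} := fun x => `[< exists y, y * x = 1 >].

Definition padic_inv (x : padic_int) : padic_int :=
  if pselect (exists y, y * x = 1) is left ex then projT1 (cid ex) else x.

Lemma padic_mulV : {in padic_unit, left_inverse 1 padic_inv *%R}.
Proof.
move=> x /asboolP ux; rewrite /padic_inv; case: pselect => // ex.
by case: (cid ex).
Qed.

Lemma padic_unitPl (x y : padic_int) : y * x = 1 -> padic_unit x.
Proof. by move=> yx1; apply/asboolP; exists y. Qed.

Lemma padic_inv_out : {in [predC padic_unit], padic_inv =1 id}.
Proof.
by move=> x /asboolPn ux; rewrite /padic_inv; case: pselect.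
Qed.

HB.instance Definition _ := GRing.ComNzRing_hasMulInverse.Build padic_int
  padic_mulV padic_unitPl padic_inv_out.

Lemma residue_mod (x : padic_int) i j :
  (residue x (i + j) = residue x i %[mod P i])%Z.
Proof.
elim: j => [|j IHj]; first by rewrite addn0.
rewrite -{}IHj addnS; apply/eqP; rewrite eqz_mod_dvd.
apply: (@dvdz_trans (P (i + j))); last by rewrite -eqz_mod_dvd residueS.
by rewrite dvdzE /= dvdn_exp2l // leq_addr.
Qed.

Lemma padic_int_neq0 (x : padic_int) :
  x != 0 -> exists i, forall j, ~~ (P i %| residue x (i + j))%Z.
Proof.
move=> x0; apply: contrapT => nx; case/eqP: x0; apply: padic_int_eq => k.
apply: contrapT => xk0; apply: nx; exists k => j.
apply/negP => /dvdz_mod0P; rewrite residue_mod residue_small => xk.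
by apply: xk0; rewrite xk /= mod0z.
Qed.

Lemma padic_integral : GRing.integral_domain_axiom padic_int.
Proof.
move=> x y xy0; apply: contrapT => /negP; rewrite negb_or => /andP[].
move=> /padic_int_neq0[i xi] /padic_int_neq0[j yj].
have: (P (i + j) %| residue x (i + j) * residue y (i + j))%Z.
  apply/dvdz_mod0P.
  by move/(congr1 (fun z => residue z (i + j))): xy0 => /= ->; rewrite mod0z.
move: (xi j) (yj i); rewrite (addnC j i) !dvdzE abszM !absz_nat.
set a := absz _; set b := absz _ => ai bj.
have prp := valP p.
have a0 : (0 < a)%N by rewrite lt0n; apply: contraNneq ai => ->; rewrite dvdn0.
have b0 : (0 < b)%N by rewrite lt0n; apply: contraNneq bj => ->; rewrite dvdn0.
move: ai bj; rewrite !pfactor_dvdn ?muln_gt0 ?a0 // lognM // -!ltnNge => ai bj.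
apply/negP; rewrite -ltnNge -addSn; apply: leq_trans (leq_add ai (ltnW bj)) _.
by rewrite leqnn.
Qed.

HB.instance Definition _ :=
  GRing.ComUnitRing_isIntegral.Build padic_int padic_integral.

End PadicIntegers.

Definition padic (p : prime_number) : fieldType := {fraction (padic_int p)}.

Definition squarefree (n : nat) : Prop :=
  forall d : nat, (d ^ 2 %| n)%N -> d = 1%N.

(** [TernaryForm a b c r s t] is
    a x^2 + b y^2 + c z^2 + r y z + s z x + t x y. *)
Record ternary_form := TernaryForm {
  coef_a : int; coef_b : int; coef_c : int;
  coef_r : int; coef_s : int; coef_t : int }.

Definition form_value (f : ternary_form) (R : nzRingType) (x y z : R) : R :=
  (coef_a f)%:~R * x ^+ 2 + (coef_b f)%:~R * y ^+ 2 + (coef_c f)%:~R * z ^+ 2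
  + (coef_r f)%:~R * (y * z) + (coef_s f)%:~R * (z * x)
  + (coef_t f)%:~R * (x * y).

Definition qform (f : ternary_form) (R : nzRingType) (v : 'rV[R]_3) : R :=
  form_value f (v 0 0) (v 0 1) (v 0 2%:R).

Definition primitive_form (f : ternary_form) : Prop :=
  gcdz (coef_a f) (gcdz (coef_b f) (gcdz (coef_c f)
    (gcdz (coef_r f) (gcdz (coef_s f) (coef_t f))))) = 1.

Definition positive_definite (f : ternary_form) : Prop :=
  forall v : 'rV[rat]_3, v != 0 -> 0 < qform f v.

Definition integrally_represents (f : ternary_form) (n : int) : Prop :=
  exists x y z : int, form_value f x y z = n.

Definition integrally_equivalent (f g : ternary_form) : Prop :=
  exists2 U : 'M[int]_3, U \in unitmx &
    forall v : 'rV[int]_3, qform g v = qform f (v *m U).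

(** Linear maps of F^3 are matrices acting on row vectors from the right, so
    the composite "sigma after Sigma" is the product [Sigma *m sigma]. *)
Section OrthogonalGroup.
Variables (f : ternary_form) (F : fieldType).

Definition orthogonal (s : 'M[F]_3) : Prop :=
  s \in unitmx /\ forall v : 'rV[F]_3, qform f (v *m s) = qform f v.

Definition special_orthogonal (s : 'M[F]_3) : Prop :=
  orthogonal s /\ \det s = 1.

Definition polar (v w : 'rV[F]_3) : F :=
  qform f (v + w) - qform f v - qform f w.

Definition reflection (w x : 'rV[F]_3) : 'rV[F]_3 :=
  x - (polar x w / qform f w) *: w.

(** [spinor_norm_of s a]: the class of [a] in F^* / F^*^2 is the spinor norm of
    [s], that is, [s] is the product of the reflections in some anisotropic
    vectors w_1, ..., w_m, and f(w_1) ... f(w_m) is in the class of [a]. *)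
Definition spinor_norm_of (s : 'M[F]_3) (a : F) : Prop :=
  exists ws : seq 'rV[F]_3,
    [/\ forall w, w \in ws -> qform f w != 0,
        forall x : 'rV[F]_3, x *m s = foldr reflection x ws &
        exists2 c : F, c != 0 & \prod_(w <- ws) qform f w = a * c ^+ 2].

Definition spinor_kernel (s : 'M[F]_3) : Prop :=
  special_orthogonal s /\ spinor_norm_of s 1.

End OrthogonalGroup.

(** The quadratic space of the form f is V = Q^3 equipped with [qform f]. *)

Local Open Scope classical_set_scope.

Definition Zspan (B : 'M[rat]_3) : set 'rV[rat]_3 :=
  [set map_mx intr c *m B | c in [set: 'rV[int]_3]].

Definition is_lattice (M : set 'rV[rat]_3) : Prop :=
  exists2 B : 'M[rat]_3, B \in unitmx & M = Zspan B.

Definition standard_lattice : set 'rV[rat]_3 := Zspan 1%:M.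

(** The Z_p-submodule of Q_p^3 generated by M. *)
Definition localization (p : prime_number) (M : set 'rV[rat]_3) :
    set 'rV[padic p]_3 :=
  [set v | exists (m : nat) (c : 'rV[padic_int p]_m) (X : 'M[rat]_(m, 3)),
    (forall i, M (row i X)) /\
    v = map_mx (@FracField.tofrac _) c *m map_mx ratr X].

Arguments localization : clear implicits.

Definition lattice_in_spinor_genus (f : ternary_form)
    (L M : set 'rV[rat]_3) : Prop :=
  exists2 s : 'M[rat]_3, orthogonal f s &
    forall p : prime_number,
      exists2 S : 'M[padic p]_3, spinor_kernel f S &
        localization p M =
          [set v *m (S *m map_mx ratr s) | v in localization p L].

(** [g] is the form of the lattice [M] on the quadratic space of [f], with
    respect to some Z-basis of [M]. *)
Definition form_of_lattice (f : ternary_form) (M : set 'rV[rat]_3)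
    (g : ternary_form) : Prop :=
  exists2 B : 'M[rat]_3, B \in unitmx /\ M = Zspan B &
    forall v : 'rV[int]_3, (qform g v)%:~R = qform f (map_mx intr v *m B).

(** [g] is in the spinor genus of [f]; the form [f] itself is the form of the
    lattice Z^3 in its quadratic space. *)
Definition in_spinor_genus (f g : ternary_form) : Prop :=
  exists (M : set 'rV[rat]_3) (h : ternary_form),
    [/\ is_lattice M, lattice_in_spinor_genus f standard_lattice M,
        form_of_lattice f M h & integrally_equivalent h g].

(* Main.v *)
From HB Require Import structures.
Require Import Defs.
From mathcomp Require Import all_boot all_order all_algebra.
From mathcomp Require Import boolp classical_sets generic_quotient.
From mathcomp Require Import ring lra zify.
Set Implicit Arguments.
Unset Strict Implicit.
Unset Printing Implicit Defensive.
Import Order.TTheory GRing.Theory Num.Theory.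
Local Open Scope ring_scope.

(** Write n = u^2 + v^2 and f = x^2 + y^2 + 16 n z^2. The vectors i = (u, v, 0),
    j = (- v, u, 0) and k = (0, 0, 1/4) are orthogonal and f takes the value n
    at each of them. So (Q^3, f / n) is the space of pure rational quaternions
    with their norm, and a i + b j + c k is in the lattice L = Z^3 of f when
    a, b, c are integers and 4 divides c.

    Let M be in the spinor genus of L; after a global isometry M_p = L_p S_p
    for all p, with S_p a rotation of spinor norm 1. Some lattice N has the
    localisations (Z_p i + Z_p j + Z_p k) S_p ([lattice_gluing]). It is
    positive definite and unimodular for f / n, and such a ternary lattice is
    a sum of three squares ([unimodular_form]); so N has an orthogonal basis
    w_1, w_2, w_3 of vectors with f = n. At an odd prime w_s is in M_p. At 2 it
    is in M_2 when 4 divides the k-coordinate of w_s S_2^-1, and it remains to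
    find an s for which this holds.

    This is where spinor norms enter. The isometry T taking i, j, k to
    w_1, w_2, w_3 is, up to sign, conjugation by a rational quaternion b
    ([orthogonal_quat]), and S_p is conjugation by a p-adic quaternion whose
    norm is a square ([spinor_kernel_quat]). Hence X_p = T S_p^-1, which is an
    isometry of Z_p^3, is conjugation by a quaternion whose norm is N(b) up to
    squares. For p odd, integrality of X_p forces that norm to have even
    valuation ([odd_quat_norm]). Therefore N(b) > 0 is a power of 2 times a
    square, and for an isometry X_2 of Z_2^3 given by a quaternion of such a
    norm some entry of the last column is divisible by 4, by inspection modulo
    8 ([dyadic_quat_isom]). Its row gives the s that was wanted. *)

(** * Arithmetic of the p-adic integers *)

Section PadicArithmetic.
Variable p : prime_number.
Local Notation Zp := (padic_int p).
Local Notation P k := (((val p) ^ k)%N%:Z).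
Local Notation pi := ((val p)%:R : Zp).

Lemma residue_int (m : int) k : residue (m%:~R : Zp) k = (m %% P k)%Z.
Proof.
have -> : (m%:~R : Zp) = padic_const p m; last by [].
have aD : {morph padic_const p : a b / a + b >-> a + b}.
  by move=> a b; apply: padic_int_eq => j /=; rewrite modzDm.
have a0 : padic_const p 0 = 0 by [].
have aN a : padic_const p (- a) = - padic_const p a.
  by apply/eqP; rewrite -addr_eq0 -aD addNr a0.
have an (a : nat) : (a%:Z%:~R : Zp) = padic_const p a.
  by elim: a => // a IH; rewrite -addn1 PoszD aD -IH intrD.
by case: m => a; rewrite ?an // NegzE mulrNz an aN.
Qed.

Lemma residueD (x y : Zp) k :
  residue (x + y) k = ((residue x k + residue y k) %% P k)%Z.
Proof. by []. Qed.

Lemma residueM (x y : Zp) k :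
  residue (x * y) k = ((residue x k * residue y k) %% P k)%Z.
Proof. by []. Qed.

Lemma pi_int k : pi ^+ k = (P k)%:~R.
Proof. by rewrite -natrX. Qed.

Lemma Pk_neq0 k : P k != 0.
Proof. by rewrite eqz_nat -lt0n expn_gt0 prime_gt0 ?(valP p). Qed.

(** The quotients of the residues by p^k form a p-adic integer again: the
    residue modulo p^(k+j) determines the quotient modulo p^j. *)
Lemma residue_eq0_dvd (x : Zp) k : residue x k = 0 -> exists y, x = pi ^+ k * y.
Proof.
move=> xk.
have dvdx j : (P k %| residue x (k + j))%Z.
  by apply/dvdz_mod0P; rewrite residue_mod xk mod0z.
have coh j : ((residue x (k + j.+1) %/ P k)%Z = (residue x (k + j) %/ P k)%Z
    %[mod P j])%Z.
  apply/eqP; rewrite eqz_mod_dvd -(dvdz_mul2l (Pk_neq0 k)).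
  rewrite mulrBr ![P k * (_ %/ _)%Z]mulrC !divzK //.
  by rewrite -PoszM -expnD -eqz_mod_dvd addnS residueS.
exists (padic_lim coh); apply: padic_int_eq => j.
rewrite pi_int residueM residue_int modzMml /= modzMmr.
by rewrite mulrC divzK // addnC residue_mod residue_small.
Qed.

Lemma nat_approx (x : Zp) k :
  exists r y, (r < val p ^ k)%N /\ x = r%:R + pi ^+ k * y.
Proof.
have [|y hy] := @residue_eq0_dvd (x - (residue x k)%:~R) k.
  by rewrite -rmorphN residueD residue_int modzDmr subrr mod0z.
exists `|residue x k|%N, y.
have r0 : 0 <= residue x k by rewrite -residue_small modz_ge0 ?Pk_neq0.
split; last by rewrite -hy pmulrn gez0_abs // addrC subrK.
rewrite -ltz_nat gez0_abs // -residue_small ltz_pmod //.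
by rewrite ltz_nat expn_gt0 prime_gt0 // (valP p).
Qed.

Lemma intr_dvd (m : int) k (y : Zp) : m%:~R = pi ^+ k * y -> (P k %| m)%Z.
Proof.
move=> e; apply/dvdz_mod0P; rewrite -residue_int e pi_int residueM residue_int.
by rewrite modzz mul0r mod0z.
Qed.

Lemma intr_neq0_Zp (m : int) : m != 0 -> (m%:~R : Zp) != 0.
Proof.
move=> m0; apply/eqP => e.
have : (P `|m|%N %| m)%Z by apply: (@intr_dvd _ _ 0); rewrite e mulr0.
rewrite dvdzE /= => /dvdn_leq; rewrite lt0n absz_eq0 => /(_ m0).
by rewrite leqNgt ltn_expl // prime_gt1 // (valP p).
Qed.

Lemma pi_neq0 : pi != 0.
Proof. by have := intr_neq0_Zp (Pk_neq0 1); rewrite -pi_int expr1. Qed.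

(** A residue prime to p is invertible modulo every p^k, and the inverses,
    being unique, are compatible with reduction. *)
Lemma unit_residue (x : Zp) : residue x 1 != 0 -> x \is a GRing.unit.
Proof.
move=> x1.
have cop k : coprimez (residue x k) (P k).
  case: k => [|k]; first by rewrite expn0 coprimezE /= coprimen1.
  rewrite coprimezE /= coprimeXr // coprime_sym prime_coprime ?(valP p) //.
  apply/negP => h; move/eqP: x1; apply.
  rewrite -(residue_small x 1) -(@residue_mod _ x 1 k) add1n.
  by apply/dvdz_mod0P; rewrite dvdzE /= expn1.
have /choice[u hu] k : exists u, (u * residue x k = 1 %[mod P k])%Z.
  have /coprimezP[[a b] /= e] := cop k.
  by exists a; rewrite -e -modzDmr modzMl addr0.
have coh k : (u k.+1 = u k %[mod P k])%Z.
  apply/eqP; rewrite eqz_mod_dvd.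
  rewrite -(Gauss_dvdzr _ (n := residue x k)); last first.
    by rewrite coprimez_sym; apply: cop.
  rewrite mulrBr -eqz_mod_dvd; apply/eqP.
  rewrite ![residue x k * _]mulrC hu -modzMmr residueP modzMmr -modzMmr modz_mod.
  rewrite modzMmr.
  apply/eqP; rewrite eqz_mod_dvd; apply: (dvdz_trans (dvd_expSP p k)).
  by rewrite -eqz_mod_dvd hu.
apply/unitrP; exists (padic_lim coh).
suff e : padic_lim coh * x = 1 by rewrite [x * _]mulrC e.
apply: padic_int_eq => k; rewrite residueM /= modzMml hu.
by rewrite -(residue_int 1).
Qed.

Lemma unit_or_pi_multiple (x : Zp) : x \is a GRing.unit \/ exists y, x = pi * y.
Proof.
case: (eqVneq (residue x 1) 0) => [/residue_eq0_dvd[y ->]|/unit_residue]; last by left.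
by right; exists y; rewrite expr1.
Qed.

Lemma pi_multiple_nonunit (y : Zp) : pi * y \isn't a GRing.unit.
Proof.
apply/negP => /unitrP[z [_ e]].
have : (P 1 %| 1)%Z.
  by apply: (@intr_dvd _ 1 (y * z)); rewrite expr1 mulrA e.
rewrite dvdzE /= expn1 dvdn1.
by case: (p) => q /= qp; apply/negP; case: q qp => [|[|q]].
Qed.

Lemma intr_unit (m : int) : ~~ (val p %| `|m|)%N -> (m%:~R : Zp) \is a GRing.unit.
Proof.
move=> h; apply: unit_residue; rewrite residue_int; apply: contra h => /eqP e.
have : (P 1 %| m)%Z by apply/dvdz_mod0P.
by rewrite dvdzE /= expn1.
Qed.

Lemma four_unit : val p != 2 -> (4%:R : Zp) \is a GRing.unit.
Proof.
move=> p2; apply: (@intr_unit (Posz (2 ^ 2))).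
by rewrite absz_nat Euclid_dvdX ?(valP p) // andbT dvdn_prime2 ?(valP p).
Qed.

Lemma padic_factor (x : Zp) : x != 0 ->
  exists k, exists2 u, u \is a GRing.unit & x = pi ^+ k * u.
Proof.
move=> x0.
have [k xk] : exists k, residue x k != 0.
  apply: contrapT => h; case/eqP: x0; apply: padic_int_eq => k.
  have -> : residue (0 : Zp) k = 0 by rewrite -[0]/(0%:~R) residue_int mod0z.
  by apply/eqP; apply: contrapT => /negP hk; apply: h; exists k.
elim: k x x0 xk => [|k IH] x x0 xk.
  by case/eqP: xk; rewrite residueP expn0 modz1.
case: (unit_or_pi_multiple x) => [ux|[y e]]; first by exists 0%N, x; rewrite ?mul1r.
have y0 : y != 0 by apply: contraNneq x0 => y0; rewrite e y0 mulr0.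
have yk : residue y k != 0.
  apply: contraNneq xk => /residue_eq0_dvd[z ez]; rewrite e ez mulrA -exprS.
  by rewrite pi_int residueM residue_int modzz mul0r mod0z.
have [j [u uu eu]] := IH y y0 yk.
by exists j.+1, u; rewrite // e eu exprS mulrA.
Qed.

Lemma pi_unit_valuation a b (x y : Zp) : x \is a GRing.unit -> y \is a GRing.unit ->
  pi ^+ a * x = pi ^+ b * y -> a = b.
Proof.
wlog le : a b x y / (a <= b)%N.
  move=> H ux uy e; case/orP: (leq_total a b) => le; first exact: (H a b x y).
  by symmetry; apply: (H b a y x).
move=> ux uy e; apply/eqP; rewrite eqn_leq le /= leqNgt; apply/negP => lt.
have pa : pi ^+ a != 0 by rewrite expf_neq0 // pi_neq0.
have e' : x = pi * (pi ^+ (b - a).-1 * y).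
  apply: (mulfI pa); rewrite e !mulrA -exprSr -exprD.
  by congr (pi ^+ _ * _); rewrite addSn -addnS prednK ?subn_gt0 // subnKC.
by move: ux; rewrite e' (negbTE (pi_multiple_nonunit _)).
Qed.

End PadicArithmetic.

(** Weak approximation, by induction on the prime factors of N: correcting the
    approximation at one prime q by a multiple of N / q does no harm at the
    other primes, where q is a unit. *)
Lemma int_approx (x : forall p, padic_int p) (N : nat) : (0 < N)%N ->
  exists r : int, forall p, exists y, x p = r%:~R + N%:R * y.
Proof.
elim/ltn_ind: N => N IH N0.
case: (leqP N 1) => [N1|N1].
  have -> : N = 1%N by apply/eqP; rewrite eqn_leq N1.
  by exists 0 => p; exists (x p); rewrite mul1r add0r.
have qp := pdiv_prime N1; set q := pdiv N in qp.
have eN : N = (N %/ q * q)%N by rewrite divnK // pdiv_dvd.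
set M := (N %/ q)%N in eN.
have M0 : (0 < M)%N by move: N0; rewrite eN; case: (M).
have [|r hr] := IH M _ M0; first by rewrite eN ltn_Pmulr // prime_gt1.
pose y p := projT1 (cid (hr p)).
have hy p : x p = r%:~R + M%:R * y p by rewrite /y; case: cid.
pose Q : prime_number := exist _ q qp.
have [t [z [_ ez]]] := nat_approx (y Q) 1.
exists (r + M%:Z * t) => p.
rewrite hy.
have [z' ez'] : exists z', y p = t%:R + q%:R * z'.
  have [epq|npq] := eqVneq (val p) q.
    have -> : p = Q by apply: val_inj.
    by exists z; rewrite ez expr1.
  have uq : (q%:Z%:~R : padic_int p) \is a GRing.unit.
    apply: intr_unit => /=; rewrite dvdn_prime2 ?(valP p) //.
  by exists (q%:R^-1 * (y p - t%:R)); rewrite mulVKr // addrC subrK.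
exists z'; rewrite ez' rmorphD rmorphM /= -!pmulrn eN natrM; ring.
Qed.

(** * Explicit matrices of size 3 *)

Lemma ord4_cases (i : 'I_4) : [\/ i = 0, i = 1, i = 2%:R | i = 3%:R].
Proof.
by case: i => [[|[|[|[|//]]]] ?];
   [apply: Or41|apply: Or42|apply: Or43|apply: Or44]; apply: val_inj.
Qed.

Section ExplicitMatrices.
Variable R : Type.

Definition row3 (a b c : R) : 'rV[R]_3 := \row_i nth a [:: a; b; c] i.

Definition row4 (a b c d : R) : 'rV[R]_4 := \row_i nth a [:: a; b; c; d] i.

Definition mx3 (a b c d e f g h i : R) : 'M[R]_3 :=
  \matrix_(r, s) nth a (nth [::] [:: [:: a; b; c]; [:: d; e; f]; [:: g; h; i]] r) s.

Lemma row3_eta (x : 'rV[R]_3) : x = row3 (x 0 0) (x 0 1) (x 0 2%:R).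
Proof.
by apply/rowP => -[[|[|[|//]]] ?]; rewrite !mxE /=; congr (x _ _); apply: val_inj.
Qed.

Lemma mx3_eta (M : 'M[R]_3) :
  M = mx3 (M 0 0) (M 0 1) (M 0 2%:R) (M 1 0) (M 1 1) (M 1 2%:R)
          (M 2%:R 0) (M 2%:R 1) (M 2%:R 2%:R).
Proof.
by apply/matrixP => -[[|[|[|//]]] ?] -[[|[|[|//]]] ?]; rewrite !mxE /=;
  congr (M _ _); apply: val_inj.
Qed.

Lemma row3E a b c :
  ((row3 a b c 0 0 = a) * (row3 a b c 0 1 = b) * (row3 a b c 0 2%:R = c))%type.
Proof. by rewrite !mxE. Qed.

Lemma row4E a b c d :
  ((row4 a b c d 0 0 = a) * (row4 a b c d 0 1 = b) *
   (row4 a b c d 0 2%:R = c) * (row4 a b c d 0 3%:R = d))%type.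
Proof. by rewrite !mxE. Qed.

Lemma trmx3 a b c d e f g h i :
  (mx3 a b c d e f g h i)^T = mx3 a d g b e h c f i.
Proof.
by apply/matrixP => -[[|[|[|//]]] ?] -[[|[|[|//]]] ?]; rewrite !mxE.
Qed.

End ExplicitMatrices.

Lemma map_mx3 (R S : Type) (k : R -> S) a b c d e f g h i :
  map_mx k (mx3 a b c d e f g h i) =
  mx3 (k a) (k b) (k c) (k d) (k e) (k f) (k g) (k h) (k i).
Proof.
by apply/matrixP => -[[|[|[|//]]] ?] -[[|[|[|//]]] ?]; rewrite !mxE.
Qed.

Section ExplicitProducts.
Variable R : comNzRingType.

Lemma mulmx3 (a b c d e f g h i a' b' c' d' e' f' g' h' i' : R) :
  mx3 a b c d e f g h i *m mx3 a' b' c' d' e' f' g' h' i' =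
  mx3 (a * a' + b * d' + c * g') (a * b' + b * e' + c * h')
      (a * c' + b * f' + c * i')
      (d * a' + e * d' + f * g') (d * b' + e * e' + f * h')
      (d * c' + e * f' + f * i')
      (g * a' + h * d' + i * g') (g * b' + h * e' + i * h')
      (g * c' + h * f' + i * i').
Proof.
by apply/matrixP => -[[|[|[|//]]] ?] -[[|[|[|//]]] ?];
  rewrite !mxE !big_ord_recl big_ord0 !mxE /=; ring.
Qed.

Lemma mulrow3 (x y z a b c d e f g h i : R) :
  row3 x y z *m mx3 a b c d e f g h i =
  row3 (x * a + y * d + z * g) (x * b + y * e + z * h) (x * c + y * f + z * i).
Proof.
by apply/matrixP => j -[[|[|[|//]]] ?];
  rewrite !mxE !big_ord_recl big_ord0 !mxE /=; ring.
Qed.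

Lemma scalemx3 (k a b c d e f g h i : R) :
  k *: mx3 a b c d e f g h i =
  mx3 (k * a) (k * b) (k * c) (k * d) (k * e) (k * f) (k * g) (k * h) (k * i).
Proof. by apply/matrixP => -[[|[|[|//]]] ?] -[[|[|[|//]]] ?]; rewrite !mxE. Qed.

Lemma scalar_mx3 (k : R) : k%:M = mx3 k 0 0 0 k 0 0 0 k.
Proof.
by apply/matrixP => -[[|[|[|//]]] ?] -[[|[|[|//]]] ?]; rewrite !mxE.
Qed.

Lemma det_mx3 (a b c d e f g h i : R) :
  \det (mx3 a b c d e f g h i) =
  a * (e * i - f * h) - b * (d * i - f * g) + c * (d * h - e * g).
Proof.
have det2 (M : 'M[R]_2) :
    \det M = M ord0 ord0 * M (lift ord0 ord0) (lift ord0 ord0)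
             - M ord0 (lift ord0 ord0) * M (lift ord0 ord0) ord0.
  rewrite (expand_det_row _ ord0) !big_ord_recl big_ord0 /cofactor !det_mx11.
  rewrite !mxE /= expr0 expr1 mul1r addr0 mulN1r mulrN.
  by congr (_ * M _ _ - _ * M _ _); apply: val_inj.
rewrite (expand_det_row _ ord0) !big_ord_recl big_ord0 /cofactor !det2.
by rewrite !mxE /=; ring.
Qed.

End ExplicitProducts.

(** * Quaternions and rotations *)

Section Quaternions.
Variable R : comNzRingType.
Implicit Types q r : 'rV[R]_4.

Definition quat_norm q : R :=
  q 0 0 ^+ 2 + q 0 1 ^+ 2 + q 0 2%:R ^+ 2 + q 0 3%:R ^+ 2.

Definition quat_mul q r : 'rV[R]_4 :=
  row4 (q 0 0 * r 0 0 - q 0 1 * r 0 1 - q 0 2%:R * r 0 2%:R - q 0 3%:R * r 0 3%:R)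
    (q 0 0 * r 0 1 + q 0 1 * r 0 0 + q 0 2%:R * r 0 3%:R - q 0 3%:R * r 0 2%:R)
    (q 0 0 * r 0 2%:R - q 0 1 * r 0 3%:R + q 0 2%:R * r 0 0 + q 0 3%:R * r 0 1)
    (q 0 0 * r 0 3%:R + q 0 1 * r 0 2%:R - q 0 2%:R * r 0 1 + q 0 3%:R * r 0 0).

Definition quat_conj q : 'rV[R]_4 :=
  row4 (q 0 0) (- q 0 1) (- q 0 2%:R) (- q 0 3%:R).

Definition pure_quat (w : 'rV[R]_3) : 'rV[R]_4 :=
  row4 0 (w 0 0) (w 0 1) (w 0 2%:R).

(** The matrix, acting on columns, of the map sending a pure quaternion x to
    q x (conj q): the Euler-Rodrigues parametrisation. *)
Definition quat_rot q : 'M[R]_3 :=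
  let a := q 0 0 in let b := q 0 1 in let c := q 0 2%:R in let d := q 0 3%:R in
  mx3 (a ^+ 2 + b ^+ 2 - c ^+ 2 - d ^+ 2) (2%:R * (b * c - a * d))
      (2%:R * (b * d + a * c))
      (2%:R * (b * c + a * d)) (a ^+ 2 - b ^+ 2 + c ^+ 2 - d ^+ 2)
      (2%:R * (c * d - a * b))
      (2%:R * (b * d - a * c)) (2%:R * (c * d + a * b))
      (a ^+ 2 - b ^+ 2 - c ^+ 2 + d ^+ 2).

Lemma quat_normM q r : quat_norm (quat_mul q r) = quat_norm q * quat_norm r.
Proof. by rewrite /quat_norm /quat_mul !row4E; ring. Qed.

Lemma quat_norm_conj q : quat_norm (quat_conj q) = quat_norm q.
Proof. by rewrite /quat_norm /quat_conj !row4E; ring. Qed.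

Lemma quat_rotM q r : quat_rot (quat_mul q r) = quat_rot q *m quat_rot r.
Proof.
rewrite /quat_rot /quat_mul !row4E mulmx3.
congr mx3; ring.
Qed.

Lemma quat_rot_conj q : quat_rot (quat_conj q) = (quat_rot q)^T.
Proof. by rewrite /quat_rot /quat_conj !row4E trmx3; congr mx3; ring. Qed.

Lemma quat_rot_orthogonal q : quat_rot q *m (quat_rot q)^T = (quat_norm q ^+ 2)%:M.
Proof.
rewrite -quat_rot_conj -quat_rotM scalar_mx3 /quat_rot /quat_mul /quat_conj.
by rewrite /quat_norm !row4E; congr mx3; ring.
Qed.

Lemma det_quat_rot q : \det (quat_rot q) = quat_norm q ^+ 3.
Proof. by rewrite /quat_rot det_mx3 /quat_norm; ring. Qed.

Lemma quat_normZ k q : quat_norm (k *: q) = k ^+ 2 * quat_norm q.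
Proof. by rewrite /quat_norm !mxE; ring. Qed.

Lemma quat_rotZ k q : quat_rot (k *: q) = k ^+ 2 *: quat_rot q.
Proof. by rewrite /quat_rot !mxE scalemx3; congr mx3; ring. Qed.

End Quaternions.

Lemma map_quat_norm (R S : comNzRingType) (k : {rmorphism R -> S}) (q : 'rV[R]_4) :
  quat_norm (map_mx k q) = k (quat_norm q).
Proof. by rewrite /quat_norm !mxE !rmorphD !rmorphXn. Qed.

Lemma map_quat_rot (R S : comNzRingType) (k : {rmorphism R -> S}) (q : 'rV[R]_4) :
  quat_rot (map_mx k q) = map_mx k (quat_rot q).
Proof.
rewrite /quat_rot !mxE map_mx3.
by rewrite !(rmorphM, rmorphD, rmorphN, rmorphXn, rmorph_nat).
Qed.

Section Isometries.
Variable F : fieldType.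
Implicit Types (q r : 'rV[F]_4) (x w : 'rV[F]_3).

Definition dot x w : F := x 0 0 * w 0 0 + x 0 1 * w 0 1 + x 0 2%:R * w 0 2%:R.

(** The isometry (-1)^e times conjugation by q; in dimension 3 every isometry
    has this form, and for e even its spinor norm is the class of the norm
    of q. *)
Definition quat_isom (e : nat) q : 'M[F]_3 :=
  ((-1) ^+ e / quat_norm q) *: quat_rot q.

Lemma quat_isomM d e q r :
  quat_isom d q *m quat_isom e r = quat_isom (d + e) (quat_mul q r).
Proof.
rewrite /quat_isom -scalemxAl -scalemxAr scalerA -quat_rotM quat_normM.
by congr (_ *: _); rewrite exprD invfM; ring.
Qed.

Lemma quat_isomZ e k q : k != 0 -> quat_isom e (k *: q) = quat_isom e q.
Proof.
move=> k0; rewrite /quat_isom quat_rotZ quat_normZ scalerA; congr (_ *: _).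
by rewrite invfM; set ni := (quat_norm q)^-1; field.
Qed.

Lemma quat_rot_isom e q : quat_norm q != 0 ->
  quat_rot q = ((-1) ^+ e * quat_norm q) *: quat_isom e q.
Proof.
move=> q0; rewrite /quat_isom scalerA mulrACA -signr_odd -expr2 sqrr_sign.
by rewrite mul1r mulfV // scale1r.
Qed.

Definition quat_one : 'rV[F]_4 := row4 1 0 0 0.

Lemma quat_norm_one : quat_norm quat_one = 1.
Proof. by rewrite /quat_norm !row4E; ring. Qed.

Lemma quat_isom_one : quat_isom 0 quat_one = 1%:M.
Proof.
rewrite /quat_isom quat_norm_one expr0 divr1 scale1r scalar_mx3 /quat_rot !row4E.
by congr mx3; ring.
Qed.

Lemma quat_isomV e q : quat_norm q != 0 ->
  quat_isom e q *m quat_isom e (quat_conj q) = 1%:M.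
Proof.
move=> q0; rewrite /quat_isom -scalemxAl -scalemxAr scalerA quat_norm_conj.
rewrite quat_rot_conj quat_rot_orthogonal scale_scalar_mx; congr (_%:M).
have := sqrr_sign F e => s2; have s0 := signr_eq0 F e.
rewrite -[X in _ = X]s2; by field.
Qed.

Lemma tr_quat_isom e q : (quat_isom e q)^T = quat_isom e (quat_conj q).
Proof. by rewrite /quat_isom linearZ /= quat_rot_conj quat_norm_conj. Qed.

Lemma det_quat_isom e q : quat_norm q != 0 -> \det (quat_isom e q) = (-1) ^+ e.
Proof.
move=> q0; rewrite /quat_isom detZ det_quat_rot.
have := sqrr_sign F e => s2.
rewrite -[RHS]mulr1 -[X in _ = _ * X]s2; by field.
Qed.

Lemma quat_norm_pure w : quat_norm (pure_quat w) = dot w w.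
Proof. by rewrite /quat_norm /dot !row4E; ring. Qed.

(** A reflection is minus the half-turn about the same axis. *)
Lemma reflectE w x : dot w w != 0 ->
  x *m quat_isom 1 (pure_quat w) = x - (2%:R * dot x w / dot w w) *: w.
Proof.
move: x w; have row3P (y : 'rV[F]_3) : exists a b c, y = row3 a b c.
  by do 3!eexists; apply: row3_eta.
move=> x w; have [a [b [c ->]]] := row3P x; have [d [e [f ->]]] := row3P w.
rewrite /quat_isom -scalemxAr quat_norm_pure /quat_rot !row4E mulrow3.
rewrite /dot !row3E => w0.
by apply/rowP => -[[|[|[|//]]] ?]; rewrite !mxE /=; field.
Qed.

End Isometries.

(** * Rational isometries are given by quaternions *)

Section CartanDieudonne.
Variable F : realFieldType.
Implicit Types (x w : 'rV[F]_3) (T : 'M[F]_3).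

Lemma dot_mx x w : dot x w = (x *m w^T) 0 0.
Proof.
rewrite mxE !big_ord_recl big_ord0 !mxE /dot addr0 addrA.
by congr (_ + _ + _); congr (x _ _ * w _ _); apply: val_inj.
Qed.

Lemma dot_gt0 w : w != 0 -> 0 < dot w w.
Proof.
move=> w0; rewrite /dot -!expr2.
have h := sqr_ge0.
rewrite lt0r !addr_ge0 ?h // andbT; apply: contra w0.
rewrite !paddr_eq0 ?addr_ge0 ?h // !sqrf_eq0 => /andP[/andP[/eqP a /eqP b] /eqP c].
by rewrite [w]row3_eta a b c; apply/eqP/rowP => -[[|[|[|//]]] ?]; rewrite !mxE.
Qed.

Lemma dot_isom T x w : T *m T^T = 1%:M -> dot (x *m T) (w *m T) = dot x w.
Proof.
by move=> TT; rewrite !dot_mx trmx_mul mulmxA -[x *m T *m _]mulmxA TT mulmx1.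
Qed.

Let ei i : 'rV[F]_3 := delta_mx 0 i.

(** Moving one orthonormal vector to its target by a reflection keeps the
    basis vectors already in place, as they are orthogonal to its axis. *)
Lemma reflect_basis_vector T i : T *m T^T = 1%:M ->
  exists e q, [/\ quat_norm q != 0, ei i *m (T *m quat_isom e q) = ei i &
    forall j, ei j *m T = ei j -> ei j *m (T *m quat_isom e q) = ei j].
Proof.
move=> TT; have [Ti|Ti] := eqVneq (ei i *m T) (ei i).
  exists 0%N, (quat_one F).
  by rewrite quat_norm_one oner_eq0 quat_isom_one mulmx1 Ti.
pose w := ei i *m T - ei i.
have w0 : dot w w != 0 by apply/lt0r_neq0/dot_gt0; rewrite subr_eq0.
have eii : dot (ei i) (ei i) = 1.
  by rewrite dot_mx trmx_delta mul_delta_mx mxE !eqxx.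
have Tii : dot (ei i *m T) (ei i *m T) = 1 by rewrite dot_isom.
exists 1%N, (pure_quat w); rewrite quat_norm_pure; split=> //.
  rewrite mulmxA reflectE // (_ : _ / _ = 1).
    by rewrite scale1r /w subKr.
  apply: (mulIf w0); rewrite divfK // mul1r.
  move: eii Tii; rewrite /w /dot !mxE; set a := ei i *m T; lra.
move=> j Tj; rewrite mulmxA Tj reflectE //.
suff -> : dot (ei j) w = 0 by rewrite mulr0 mul0r scale0r subr0.
have := dot_isom (ei j) (ei i) TT; rewrite Tj /w /dot !mxE => h.
lra.
Qed.

(** Cartan-Dieudonne: the basis vectors are put back in place one after the
    other by reflections, each of which is given by a pure quaternion. *)
Lemma orthogonal_quat T : T *m T^T = 1%:M ->
  exists e q, quat_norm q != 0 /\ T = quat_isom e q.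
Proof.
move=> TT.
have ortho (U : 'M[F]_3) e q : U *m U^T = 1%:M -> quat_norm q != 0 ->
    (U *m quat_isom e q) *m (U *m quat_isom e q)^T = 1%:M.
  move=> UU q0; rewrite trmx_mul mulmxA -[U *m _ *m _]mulmxA tr_quat_isom.
  by rewrite quat_isomV // mulmx1.
have [e0 [q0 [n0 T0 _]]] := reflect_basis_vector 0 TT.
have TT0 := ortho _ e0 _ TT n0.
have [e1 [q1 [n1 T1 K1]]] := reflect_basis_vector 1 TT0.
have TT1 := ortho _ e1 _ TT0 n1.
have [e2 [q2 [n2 T2 K2]]] := reflect_basis_vector 2%:R TT1.
have {}T0 := K2 _ (K1 _ T0); have {K1 K2}T1 := K2 _ T1.
move: T0 T1 T2; rewrite -!mulmxA !quat_isomM.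
set e := (_ + _)%N; set q := quat_mul _ _ => T0 T1 T2.
have nq : quat_norm q != 0 by rewrite !quat_normM !mulf_neq0.
have Tq : T *m quat_isom e q = 1%:M.
  apply/row_matrixP => i; rewrite row1 rowE -/(ei i).
  case: i => [[|[|[|//]]] ?].
  - by rewrite (_ : Ordinal _ = 0) ?T0 //; apply: val_inj.
  - by rewrite (_ : Ordinal _ = 1) ?T1 //; apply: val_inj.
  - by rewrite (_ : Ordinal _ = 2%:R) ?T2 //; apply: val_inj.
exists e, (quat_conj q); rewrite quat_norm_conj; split=> //.
by rewrite -[LHS]mulmx1 -(quat_isomV e nq) mulmxA Tq mul1mx.
Qed.

End CartanDieudonne.

(** * Positive definite unimodular ternary lattices *)

(** The Gram matrix of v1, v2, v3, where v0 + v1 + v2 + v3 = 0 and the Selling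
    parameters - v_a . v_b for the pairs 01, 02, 03, 12, 13, 23 are
    x, y, z, p, q, r; it is the reduced Laplacian of the complete graph on four
    vertices with these edge weights. *)
Definition obtuse_gram (x y z p q r : int) : 'M[int]_3 :=
  mx3 (x + p + q) (- p) (- q) (- p) (y + p + r) (- r) (- q) (- r) (z + q + r).

Lemma addn_eq1E (a b : nat) : (a + b = 1)%N -> (b = 1)%N \/ (a = 1)%N.
Proof. by case: a => [|[|a]]; case: b => [|[|b]]; auto. Qed.

Lemma muln3_eq1 (a b c : nat) : (a * b * c = 1)%N -> [/\ a = 1, b = 1 & c = 1]%N.
Proof. by move/eqP; rewrite !muln_eq1 => /andP[/andP[/eqP -> /eqP ->] /eqP ->]. Qed.

Ltac tree_case V :=
  match goal with |- (?a * ?b * ?c = 1)%N -> _ => case/muln3_eq1 => ? ? ? end;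
  subst; exists V; [by rewrite unitmxE det_mx3 | ];
  rewrite trmx3 mulmx3 /obtuse_gram; congr mx3; lia.

(** By the matrix-tree theorem the determinant is the sum over the 16 spanning
    trees of the products of their edge weights. For it to be 1 with weights in
    N, one tree has all weights 1 and the edges outside it have weight 0; then
    the Gram matrix is V V^T for the reduced incidence matrix V of that tree. *)
Lemma obtuse_gram_det1 (x y z p q r : nat) :
  \det (obtuse_gram x y z p q r) = 1 ->
  exists2 V : 'M[int]_3, V \in unitmx & obtuse_gram x y z p q r = V *m V^T.
Proof.
rewrite /obtuse_gram det_mx3 => det1.
have {det1} trees : (x * y * z + x * y * q + x * y * r + x * z * p + x * z * r +
    x * p * q + x * p * r + x * q * r + y * z * p + y * z * q + y * p * q +
    y * p * r + y * q * r + z * p * q + z * p * r + z * q * r = 1)%N.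
  apply/eqP; rewrite -eqz_nat !PoszD !PoszM; apply/eqP; rewrite -[RHS]det1; ring.
(* The columns of V are e_a - e_b for the edges ab of the tree, with e_0 = 0. *)
have trees1 := trees; move: trees1; (do 15?[case/addn_eq1E; last first]).
- tree_case (mx3 1 0 0 0 1 0 0 0 1 : 'M[int]_3).
- tree_case (mx3 1 0 1 0 1 0 0 0 (-1) : 'M[int]_3).
- tree_case (mx3 1 0 0 0 1 1 0 0 (-1) : 'M[int]_3).
- tree_case (mx3 1 0 1 0 0 (-1) 0 1 0 : 'M[int]_3).
- tree_case (mx3 1 0 0 0 0 1 0 1 (-1) : 'M[int]_3).
- tree_case (mx3 1 1 1 0 (-1) 0 0 0 (-1) : 'M[int]_3).
- tree_case (mx3 1 1 0 0 (-1) 1 0 0 (-1) : 'M[int]_3).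
- tree_case (mx3 1 1 0 0 0 1 0 (-1) (-1) : 'M[int]_3).
- tree_case (mx3 0 0 1 1 0 (-1) 0 1 0 : 'M[int]_3).
- tree_case (mx3 0 0 1 1 0 0 0 1 (-1) : 'M[int]_3).
- tree_case (mx3 0 1 1 1 (-1) 0 0 0 (-1) : 'M[int]_3).
- tree_case (mx3 0 1 0 1 (-1) 1 0 0 (-1) : 'M[int]_3).
- tree_case (mx3 0 1 0 1 0 1 0 (-1) (-1) : 'M[int]_3).
- tree_case (mx3 0 1 1 0 (-1) 0 1 0 (-1) : 'M[int]_3).
- tree_case (mx3 0 1 0 0 (-1) 1 1 0 (-1) : 'M[int]_3).
- tree_case (mx3 0 1 0 0 0 1 1 (-1) (-1) : 'M[int]_3).
Qed.

Definition posdef_mx (P : 'M[int]_3) : Prop :=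
  forall x : 'rV[int]_3, x != 0 -> 0 < (x *m P *m x^T) 0 0.

(** Half the sum of the squared lengths of v0, ..., v3. *)
Definition superbase_norm (P : 'M[int]_3) : int :=
  P 0 0 + P 1 1 + P 2%:R 2%:R + P 0 1 + P 0 2%:R + P 1 2%:R.

Lemma posdef_congruent (P E : 'M[int]_3) :
  E \in unitmx -> posdef_mx P -> posdef_mx (E *m P *m E^T).
Proof.
move=> uE posP x x0; have := posP (x *m E).
rewrite trmx_mul !mulmxA; apply; apply: contraNneq x0 => xE.
by rewrite -[x]mulmx1 -(mulmxV uE) mulmxA xE mul0mx.
Qed.

Lemma row_mx_form a b c d e f g h i (x y z : int) :
  (row3 x y z *m mx3 a b c d e f g h i *m (row3 x y z)^T) 0 0 =
  x * (x * a + y * d + z * g) + y * (x * b + y * e + z * h)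
  + z * (x * c + y * f + z * i).
Proof.
rewrite mulrow3 mxE !big_ord_recl big_ord0 !mxE /=; ring.
Qed.

Lemma superbase_norm_ge0 (P : 'M[int]_3) :
  P^T = P -> posdef_mx P -> 0 <= superbase_norm P.
Proof.
have neq0 (x y z : int) : [|| x != 0, y != 0 | z != 0] -> row3 x y z != 0.
  by apply: contraTneq => /rowP e; move: (e 0) (e 1) (e 2%:R);
    rewrite !mxE /= => -> -> ->.
rewrite [P]mx3_eta trmx3 /superbase_norm => sP pP; rewrite !mxE /=.
have := pP _ (neq0 1 0 0 isT); have := pP _ (neq0 0 1 0 isT).
have := pP _ (neq0 0 0 1 isT); have := pP _ (neq0 1 1 1 isT).
move: sP => /matrixP sP; move: (sP 0 1) (sP 0 2%:R) (sP 1 2%:R).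
rewrite !row_mx_form !mxE /=; lia.
Qed.

(** Selling's reduction: as long as two vectors of the superbase make an acute
    angle, v_a . v_b > 0, passing to - v_a, v_b, v_c + v_a, v_d + v_a decreases
    the sum of the squared lengths. In the end the superbase is obtuse. *)
Theorem unimodular_form (P : 'M[int]_3) :
  P^T = P -> posdef_mx P -> \det P = 1 ->
  exists2 V : 'M[int]_3, V \in unitmx & P = V *m V^T.
Proof.
have [m] := ubnP `|superbase_norm P|%N.
elim: m P => // m IH P lt_m sP pP dP.
have step (E : 'M[int]_3) : \det E ^+ 2 = 1 ->
    superbase_norm (E *m P *m E^T) < superbase_norm P ->
    exists2 V : 'M[int]_3, V \in unitmx & P = V *m V^T.
  move=> dE lt.
  have uE : E \in unitmx.
    by rewrite unitmxE; apply/unitrP; exists (\det E); rewrite -expr2 dE.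
  have pE := posdef_congruent uE pP.
  have sE : (E *m P *m E^T)^T = E *m P *m E^T by rewrite !trmx_mul trmxK sP mulmxA.
  have [||V uV eV] := IH _ _ sE pE.
  - have := superbase_norm_ge0 sE pE; have := superbase_norm_ge0 sP pP.
    by move: lt lt_m; lia.
  - by rewrite !det_mulmx det_tr dP mulr1 -expr2.
  exists (invmx E *m V); first by rewrite unitmx_mul unitmx_inv uE.
  rewrite trmx_mul mulmxA -[_ *m V *m _]mulmxA -eV trmx_inv !mulmxA.
  by rewrite mulVmx // mul1mx -mulmxA mulmxV ?unitmx_tr // mulmx1.
move: sP step dP; clear IH pP lt_m; rewrite [P]mx3_eta.
move: (P 0 0) (P 0 1) (P 0 2%:R) (P 1 0) (P 1 1) (P 1 2%:R) (P 2%:R 0)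
  (P 2%:R 1) (P 2%:R 2%:R) => a t s t' b r s' r' c sP.
have {sP} [-> -> ->] : [/\ t' = t, s' = s & r' = r].
  by move: sP => /matrixP sP; move: (sP 0 1) (sP 0 2%:R) (sP 1 2%:R);
     rewrite !mxE.
move=> step dP.
have move_with a1 a2 a3 b1 b2 b3 c1 c2 c3 := step (mx3 a1 a2 a3 b1 b2 b3 c1 c2 c3).
(* The pairs of vectors are taken in the order 12, 13, 23, 01, 02, 03, and the
   rows of each matrix give the new v1, v2, v3. *)
have [t_le0|t_gt0] := lerP t 0; last first.
  apply: (move_with (-1) 0 0 0 1 0 1 0 1); first by rewrite det_mx3.
  by rewrite trmx3 !mulmx3 /superbase_norm !mxE /=; lia.
have [s_le0|s_gt0] := lerP s 0; last first.
  apply: (move_with (-1) 0 0 1 1 0 0 0 1); first by rewrite det_mx3.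
  by rewrite trmx3 !mulmx3 /superbase_norm !mxE /=; lia.
have [r_le0|r_gt0] := lerP r 0; last first.
  apply: (move_with 1 1 0 0 (-1) 0 0 0 1); first by rewrite det_mx3.
  by rewrite trmx3 !mulmx3 /superbase_norm !mxE /=; lia.
have [x_ge0|x_lt0] := lerP 0 (a + t + s); last first.
  apply: (move_with 1 0 0 (-1) 0 (-1) (-1) (-1) 0); first by rewrite det_mx3.
  by rewrite trmx3 !mulmx3 /superbase_norm !mxE /=; lia.
have [y_ge0|y_lt0] := lerP 0 (b + t + r); last first.
  apply: (move_with 0 (-1) (-1) 0 1 0 (-1) (-1) 0); first by rewrite det_mx3.
  by rewrite trmx3 !mulmx3 /superbase_norm !mxE /=; lia.
have [z_ge0|z_lt0] := lerP 0 (c + s + r); last first.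
  apply: (move_with 0 (-1) (-1) (-1) 0 (-1) 0 0 1); first by rewrite det_mx3.
  by rewrite trmx3 !mulmx3 /superbase_norm !mxE /=; lia.
have eP : mx3 a t s t b r s r c = obtuse_gram (absz (a + t + s))
    (absz (b + t + r)) (absz (c + s + r)) (absz t) (absz s) (absz r).
  by rewrite /obtuse_gram; congr mx3; lia.
by move: dP; rewrite eP; apply: obtuse_gram_det1.
Qed.

(** * The p-adic fields *)

Section RationalsInCharacteristicZero.
Variable F : fieldType.
Hypothesis intr_neq0 : forall m : int, m != 0 -> m%:~R != 0 :> F.

Lemma ratr_frac (x : rat) (a b : int) :
  b != 0 -> x * b%:~R = a%:~R -> ratr x = a%:~R / b%:~R :> F.
Proof.
move=> b0 e.
have ez : numq x * b = a * denq x.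
  by apply: (@intr_inj rat); rewrite !rmorphM /= -e numqE mulrAC.
apply: (mulIf (intr_neq0 (denq_neq0 x))).
rewrite /ratr divfK ?intr_neq0 ?denq_neq0 //.
apply: (mulIf (intr_neq0 b0)); rewrite -intrM ez intrM.
by rewrite mulrAC divfK ?intr_neq0.
Qed.

Lemma ratr_zmod_char0 : zmod_morphism (@ratr F).
Proof.
move=> x y.
have ex : x * (denq x)%:~R = (numq x)%:~R by rewrite numqE.
have ey : y * (denq y)%:~R = (numq y)%:~R by rewrite numqE.
rewrite (@ratr_frac _ (numq x * denq y - numq y * denq x) (denq x * denq y)).
- rewrite /ratr !(intrM, intrD, mulrNz).
  have := intr_neq0 (denq_neq0 x); have := intr_neq0 (denq_neq0 y).
  by move=> ? ?; field; apply/andP.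
- by rewrite mulf_neq0 // denq_neq0.
- by rewrite !(intrM, intrD, mulrNz) -ex -ey; ring.
Qed.

Lemma ratr_monoid_char0 : monoid_morphism (@ratr F).
Proof.
split=> [|x y].
  by rewrite (@ratr_frac _ 1 1) // ?divr1 // mulr1.
have ex : x * (denq x)%:~R = (numq x)%:~R by rewrite numqE.
have ey : y * (denq y)%:~R = (numq y)%:~R by rewrite numqE.
rewrite (@ratr_frac _ (numq x * numq y) (denq x * denq y)).
- rewrite /ratr !intrM.
  have := intr_neq0 (denq_neq0 x); have := intr_neq0 (denq_neq0 y).
  by move=> ? ?; field; apply/andP.
- by rewrite mulf_neq0 // denq_neq0.
- by rewrite !intrM -ex -ey; ring.
Qed.

End RationalsInCharacteristicZero.

Section PadicField.
Variable p : prime_number.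
Local Notation Zp := (padic_int p).
Local Notation K := (padic p).
Local Notation pi := ((val p)%:R : Zp).

Definition of_Zp : Zp -> K := @FracField.tofrac Zp.
HB.instance Definition _ := GRing.RMorphism.on of_Zp.

Lemma of_Zp_inj : injective of_Zp.
Proof. by move=> x y /eqP; rewrite /of_Zp tofrac_eq => /eqP. Qed.

Lemma map_of_Zp_inj m n :
  injective (map_mx of_Zp : 'M[Zp]_(m, n) -> 'M[K]_(m, n)).
Proof.
move=> X Y /matrixP e; apply/matrixP => i j; apply: of_Zp_inj.
by have := e i j; rewrite !mxE.
Qed.

Lemma of_Zp_eq0 x : (of_Zp x == 0) = (x == 0).
Proof. by rewrite -(rmorph0 of_Zp) (inj_eq of_Zp_inj). Qed.

Lemma padicP (k : K) : exists x, exists2 y, y != 0 & k = of_Zp x / of_Zp y.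
Proof.
elim/quotW: k => x; have d0 : \d_x != 0 := denom_ratioP x.
exists \n_x, \d_x => //.
have ed : of_Zp \d_x != 0 by rewrite /of_Zp tofrac_eq0.
apply: (mulIf ed); rewrite divfK // /of_Zp; unlock FracField.tofrac.
rewrite -[LHS]FracField.pi_mul; apply/eqmodP; rewrite /= FracField.equivfE.
by rewrite /FracField.mulf !numden_Ratio ?mulf_neq0 ?oner_eq0 // !mulr1 mulrC.
Qed.

Lemma intr_neq0_Qp (m : int) : m != 0 -> m%:~R != 0 :> K.
Proof. by move=> m0; rewrite -(rmorph_int of_Zp) of_Zp_eq0 intr_neq0_Zp. Qed.

Definition of_Q : rat -> K := ratr.

HB.instance Definition _ := GRing.isZmodMorphism.Build rat K of_Q
  (ratr_zmod_char0 intr_neq0_Qp).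
HB.instance Definition _ := GRing.isMonoidMorphism.Build rat K of_Q
  (ratr_monoid_char0 intr_neq0_Qp).

Lemma map_of_Q_intr m n (X : 'M[int]_(m, n)) :
  map_mx of_Q (map_mx intr X) = map_mx of_Zp (map_mx intr X).
Proof. by apply/matrixP => i j; rewrite !mxE !rmorph_int. Qed.

Lemma primitive_multiple n (v : 'rV[K]_n) : v != 0 ->
  exists c w i, [/\ c != 0, v = c *: map_mx of_Zp w & w 0 i \is a GRing.unit].
Proof.
move=> v0.
have /choice[x /choice[y xy]] (i : 'I_n) : exists x, exists y,
    y != 0 /\ v 0 i * of_Zp y = of_Zp x.
  have [x [y y0 e]] := padicP (v 0 i).
  by exists x, y; split=> //; rewrite e divfK // of_Zp_eq0.
pose b := \prod_i y i.
have b0 : b != 0 by apply/prodf_neq0 => i _; case: (xy i).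
have [w0 ew0] : exists w0, of_Zp b *: v = map_mx of_Zp w0.
  exists (\row_i (x i * \prod_(j | j != i) y j)); apply/rowP => i.
  rewrite !mxE rmorphM /= -(xy i).2 /b (bigD1 i) //= rmorphM /=.
  by rewrite mulrC mulrA.
have [i wi0] : exists i, w0 0 i != 0.
  apply/existsP; rewrite -negb_forall; apply: contra v0 => /forallP h.
  have : of_Zp b *: v == 0.
    by rewrite ew0; apply/eqP/rowP => i; rewrite !mxE (eqP (h i)) rmorph0.
  by rewrite scaler_eq0 of_Zp_eq0 (negbTE b0).
have [k [u uu eu]] := padic_factor wi0.
have {v0} [c [w [j [c0 ew uw]]]] : exists c w j,
    [/\ c != 0, map_mx of_Zp w0 = of_Zp c *: map_mx of_Zp w
      & w 0 j \is a GRing.unit].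
  elim: k w0 {ew0 wi0} eu => [|k IH] w0 eu.
    exists 1, w0, i; split; rewrite ?oner_eq0 ?rmorph1 ?scale1r //.
    by rewrite eu mul1r.
  have [[j uj]|nu] := pselect (exists j, w0 0 j \is a GRing.unit).
    by exists 1, w0, j; split; rewrite ?oner_eq0 ?rmorph1 ?scale1r.
  have /choice[z ez] (j : 'I_n) : exists z, w0 0 j = pi * z.
    by case: (unit_or_pi_multiple (w0 0 j)) => // uj; case: nu; exists j.
  have [|c [w [j [c0 ew uw]]]] := IH (\row_j z j).
    by rewrite mxE; apply: (mulfI (pi_neq0 p)); rewrite -ez eu exprS mulrA.
  exists (pi * c), w, j; split; rewrite ?mulf_neq0 ?pi_neq0 //.
  rewrite rmorphM -scalerA -ew; apply/rowP => l.
  by rewrite !mxE ez rmorphM.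
exists (of_Zp c / of_Zp b), w, j; split=> //.
  by rewrite mulf_neq0 ?invr_eq0 ?of_Zp_eq0.
rewrite mulrC -scalerA -ew -ew0 scalerA mulVf ?scale1r //.
by rewrite of_Zp_eq0.
Qed.

Lemma even_logn_of_square (r : nat) (d : K) (u : Zp) :
  (0 < r)%N -> u \is a GRing.unit ->
  r%:R = d ^+ 2 * of_Zp u -> ~~ odd (logn (val p) r).
Proof.
move=> r0 uu e.
have [a [b b0 ed]] := padicP d.
have eZ : r%:R * b ^+ 2 = a ^+ 2 * u.
  apply: of_Zp_inj; rewrite [LHS]rmorphM [RHS]rmorphM /= !rmorphXn /=.
  rewrite rmorph_nat e ed.
  by rewrite exprMn exprVn mulrAC divfK // expf_neq0 // of_Zp_eq0.
have a0 : a != 0.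
  apply/eqP => a0; move/eqP: eZ; rewrite a0 expr0n /= mul0r mulf_eq0 expf_eq0.
  rewrite (negbTE b0) orbF; apply/negP.
  by apply: (@intr_neq0_Zp p r); rewrite eqz_nat -lt0n.
have [i [a' ua ea]] := padic_factor a0; have [j [b' ub eb]] := padic_factor b0.
have [m cm er] := pfactor_coprime (valP p) r0.
have um : (m%:R : Zp) \is a GRing.unit.
  by apply: (@intr_unit p m); rewrite /= -prime_coprime ?(valP p).
move: eZ; rewrite {1}er ea eb natrM natrX => eZ.
have : (logn (val p) r + j.*2 = i.*2)%N.
  apply: (@pi_unit_valuation p _ _ (m%:R * b' ^+ 2) (a' ^+ 2 * u)).
  - by rewrite unitrM um unitrX.
  - by rewrite unitrM uu unitrX.
  rewrite exprD -!muln2 !exprM.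
  transitivity (m%:R * pi ^+ logn (val p) r * (pi ^+ j * b') ^+ 2); first ring.
  by rewrite eZ; ring.
by move/(congr1 odd); rewrite oddD !odd_double addbF => ->.
Qed.

End PadicField.

(** * Integral at every prime *)

Lemma integral_everywhere (x : rat) :
  (forall p, exists z, of_Q p x = of_Zp z) -> exists m : int, x = m%:~R.
Proof.
move=> h; exists (numq x).
suff d1 : denq x = 1 by rewrite -[LHS]divq_num_den d1 divr1.
apply/eqP; rewrite -[denq x]gez0_abs ?(ltW (denq_gt0 x)) // eqz_nat.
apply: contraT => dn1.
have [q qp qd] : exists2 q, prime q & (q %| `|denq x|)%N.
  exists (pdiv `|denq x|); last exact: pdiv_dvd.
  by apply: pdiv_prime; have := denq_gt0 x; move: dn1; lia.
pose p : prime_number := exist _ q qp.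
have [z ez] := h p.
have : (numq x)%:~R = (denq x)%:~R * z.
  apply: (@of_Zp_inj p); rewrite rmorphM /= !rmorph_int -ez.
  by rewrite -!(rmorph_int (of_Q p)) -rmorphM numqE mulrC.
have /dvdzP[d ed] : (q%:Z %| denq x)%Z by rewrite dvdzE.
rewrite ed mulrC intrM mulrA => en.
have : (q%:Z %| numq x)%Z.
  have := @intr_dvd p (numq x) 1 (z * d%:~R); rewrite expn1; apply.
  by rewrite en expr1 /= -pmulrn; ring.
rewrite dvdzE /= => qn.
have := coprime_num_den x; rewrite /coprime => /eqP g1.
have : (q %| gcdn `|numq x| `|denq x|)%N by rewrite dvdn_gcd qn.
by rewrite g1 dvdn1 => /eqP q1; move: (qp); rewrite q1.
Qed.

Lemma integral_everywhere_mx m n (X : 'M[rat]_(m, n)) :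
  (forall p, exists Z, map_mx (of_Q p) X = map_mx (@of_Zp p) Z) ->
  exists Z : 'M[int]_(m, n), X = map_mx intr Z.
Proof.
move=> h.
have hij i j : exists z : int, X i j = z%:~R.
  apply: integral_everywhere => p; have [Z /matrixP/(_ i j)] := h p.
  by rewrite !mxE => e; exists (Z i j).
have /choice[Z hZ] i : exists Zi : 'I_n -> int, forall j, X i j = (Zi j)%:~R.
  by have /choice[Zi hZi] := hij i; exists Zi.
by exists (\matrix_(i, j) Z i j); apply/matrixP => i j; rewrite !mxE.
Qed.

Lemma unit_everywhere (m : int) :
  (forall p, exists z : padic_int p, m%:~R * z = 1) -> `|m|%N = 1%N.
Proof.
move=> h; apply/eqP; apply: contraT => m1.
have [q qp qd] : exists2 q, prime q & (q %| `|m|)%N.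
  have [m0|m0] := eqVneq m 0; first by exists 2%N; rewrite // m0 dvdn0.
  exists (pdiv `|m|); last exact: pdiv_dvd.
  by apply: pdiv_prime; move: m1 m0; lia.
pose p : prime_number := exist _ q qp.
have [z ez] := h p.
have /dvdzP[d ed] : (q%:Z %| m)%Z by rewrite dvdzE.
have : ((val p)%:R * (d%:~R * z)) \is a GRing.unit.
  suff -> : (val p)%:R * (d%:~R * z) = 1 :> padic_int p by rewrite unitr1.
  rewrite -[RHS]ez ed intrM -[val p]/q -[q%:Z%:~R]pmulrn; ring.
by rewrite (negbTE (pi_multiple_nonunit _)).
Qed.

(** * Quaternions of integral isometries *)

Section IntegralRotations.
Variable p : prime_number.
Local Notation Zp := (padic_int p).
Local Notation K := (padic p).

(** The isometry depends only on the line of q, so q may be taken primitive;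
    then integrality says that the norm divides all entries of the rotation
    matrix. *)
Lemma primitive_quat_rot e (q : 'rV[K]_4) (X : 'M[Zp]_3) :
  quat_norm q != 0 -> quat_isom e q = map_mx (@of_Zp p) X ->
  exists c w i, [/\ c != 0, q = c *: map_mx (@of_Zp p) w,
    w 0 i \is a GRing.unit & quat_rot w = ((-1) ^+ e * quat_norm w) *: X].
Proof.
move=> q0 eX.
have [|c [w [i [c0 eq uw]]]] := @primitive_multiple p _ q.
  by apply: contraNneq q0 => ->; rewrite /quat_norm !mxE expr0n /= !addr0.
exists c, w, i; split=> //.
apply: map_of_Zp_inj.
rewrite -map_quat_rot map_mxZ rmorphM rmorph_sign /= -map_quat_norm -eX.
rewrite [in quat_isom _ q]eq quat_isomZ //; apply: quat_rot_isom.
by apply: contraNneq q0; rewrite eq quat_normZ => ->; rewrite mulr0.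
Qed.

End IntegralRotations.

Lemma four_squares_of_rot (R : comNzRingType) (w : 'rV[R]_4) i :
  exists a b c : R, 4%:R * w 0 i ^+ 2 = quat_norm w + a * quat_rot w 0 0
    + b * quat_rot w 1 1 + c * quat_rot w 2%:R 2%:R.
Proof.
rewrite /quat_norm !mxE /=.
have [->|->|->|->] := ord4_cases i.
- by exists 1, 1, 1; ring.
- by exists 1, (-1), (-1); ring.
- by exists (-1), 1, (-1); ring.
- by exists (-1), (-1), 1; ring.
Qed.

(** With q primitive, a prime p dividing the norm would divide the diagonal of
    the rotation matrix, hence 4 q_i^2 for every coordinate q_i. *)
Lemma odd_quat_norm (p : prime_number) e (q : 'rV[padic p]_4)
    (X : 'M[padic_int p]_3) :
  val p != 2 -> quat_norm q != 0 -> quat_isom e q = map_mx (@of_Zp p) X ->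
  exists c u, u \is a GRing.unit /\ quat_norm q = c ^+ 2 * of_Zp u.
Proof.
move=> p2 q0 eX; have [c [w [i [c0 eq uw ew]]]] := primitive_quat_rot q0 eX.
exists c, (quat_norm w); split; last by rewrite eq quat_normZ map_quat_norm.
case: (unit_or_pi_multiple (quat_norm w)) => // -[y ey].
have u4 : (4%:R * w 0 i ^+ 2) \is a GRing.unit.
  by rewrite unitrM unitrX // andbT four_unit.
have [a [b [d e4]]] := four_squares_of_rot w i.
move: u4; rewrite e4 ew !mxE ey.
rewrite (_ : _ + _ = (val p)%:R * (y + (-1) ^+ e * y *
  (a * X 0 0 + b * X 1 1 + d * X 2%:R 2%:R))); last by ring.
by rewrite (negbTE (pi_multiple_nonunit _)).
Qed.

Definition prime_two : prime_number := exist _ 2 isT.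

Definition nat_norm a b c d := (a ^ 2 + b ^ 2 + c ^ 2 + d ^ 2)%N.

(** The last column of the rotation matrix modulo 16, with 7 and 15 standing for
    -1 modulo 8 and 16 so that the entries stay in N. *)
Definition nat_col (i : nat) a b c d :=
  nth 0%N [:: 2 * (b * d + a * c); 2 * (c * d + 7 * (a * b));
              a ^ 2 + d ^ 2 + 15 * (b ^ 2 + c ^ 2)]%N i.

Definition dvd_col a b c d k :=
  has (fun i => k %| nat_col i a b c d)%N (iota 0 3).

(** For a primitive q whose norm is 2^m times a square unit, hence 1 modulo 8
    times 2^m, some entry of the last column is divisible by 4 times 2^m.
    Coordinates modulo 8 determine the norm and the column modulo 16, and the
    norm of a primitive q is not divisible by 8, so that m <= 2. *)
Definition dyadic_check a b c d :=
  let N := nat_norm a b c d in let col := dvd_col a b c d in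
  ~~ [|| odd a, odd b, odd c | odd d] ||
  [&& N %% 8 != 0, (N %% 8 == 1) ==> col 4,
      (N %% 16 == 2) ==> col 8 & (N %% 16 == 4) ==> col 16]%N.

Lemma dyadic_checkT :
  all (fun a => all (fun b => all (fun c => all (dyadic_check a b c)
    (iota 0 8)) (iota 0 8)) (iota 0 8)) (iota 0 8).
Proof. by vm_compute. Qed.

Lemma dyadic_checkP a b c d :
  (a < 8)%N -> (b < 8)%N -> (c < 8)%N -> (d < 8)%N -> dyadic_check a b c d.
Proof.
move=> a8 b8 c8 d8.
have mem k : (k < 8)%N -> k \in iota 0 8 by rewrite mem_iota.
have /allP/(_ _ (mem _ a8))/allP/(_ _ (mem _ b8))/allP/(_ _ (mem _ c8))/allP :=
  dyadic_checkT.
by apply; apply: mem.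
Qed.

Local Notation Z2 := (padic_int prime_two).

Local Notation pi2 := ((val prime_two)%:R : Z2).

Lemma pi2E : pi2 = 2%:R. Proof. by []. Qed.

Lemma unit_sqr_mod8 (s : Z2) : s \is a GRing.unit ->
  exists v, s ^+ 2 = 1 + 8%:R * v.
Proof.
have [r [y [r8 ->]]] := nat_approx s 3; rewrite pi2E => u.
have r_odd : odd r.
  apply: contraLR u => er.
  have -> : r%:R + 2%:R ^+ 3 * y = pi2 * (r./2%:R + 4%:R * y).
    rewrite -[r in LHS]odd_double_half (negbTE er) add0n -mul2n natrM pi2E.
    by ring.
  exact: pi_multiple_nonunit.
have [k ek] : exists k, (r * r = 1 + 8 * k)%N.
  by case: r r_odd r8 {u} => [|[|[|[|[|[|[|[|]]]]]]]] //= _ _;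
    [exists 0%N|exists 1%N|exists 3%N|exists 6%N].
exists (k%:R + 2%:R * r%:R * y + 8%:R * y ^+ 2).
have ekR : r%:R * r%:R = 1 + 8%:R * k%:R :> Z2.
  by rewrite -natrM ek natrD natrM.
transitivity (r%:R * r%:R + 16%:R * r%:R * y + 64%:R * y ^+ 2); first by ring.
by rewrite ekR; ring.
Qed.

(** The norm of an integral quaternion being of the form 2^t d^2, its odd part
    is the square of a unit. *)
Lemma dyadic_norm (N a b : Z2) (t : nat) : a != 0 -> b != 0 ->
  N * b ^+ 2 = (2 ^ t)%:R * a ^+ 2 ->
  exists m s, s \is a GRing.unit /\ N = pi2 ^+ m * s ^+ 2.
Proof.
move=> a0 b0 eN.
have [k [a' ua ea]] := padic_factor a0; have [j [b' ub eb]] := padic_factor b0.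
pose s := a' * b'^-1.
have us : s \is a GRing.unit by rewrite unitrM ua unitrV ub.
have ea' : a' = s * b' by rewrite /s mulrVK.
have pn k' : pi2 ^+ k' != 0 by rewrite expf_neq0 // pi_neq0.
have b'0 : b' ^+ 2 != 0.
  by rewrite expf_neq0 //; apply: contraTneq ub => ->; rewrite unitr0.
have {eN}eN : N * pi2 ^+ (j * 2) = pi2 ^+ (t + k * 2) * s ^+ 2.
  apply: (mulIf b'0); rewrite exprD !exprM.
  transitivity (N * b ^+ 2); first by rewrite eb; ring.
  by rewrite eN ea ea' natrX pi2E; ring.
have [le|lt] := leqP (j * 2) (t + k * 2).
  exists (t + k * 2 - j * 2)%N, s; split=> //.
  apply: (mulIf (pn (j * 2)%N)); rewrite eN mulrAC -exprD.
  by rewrite subnK.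
have : s ^+ 2 = pi2 * (pi2 ^+ (j * 2 - (t + k * 2)).-1 * N).
  apply: (mulfI (pn (t + k * 2)%N)); rewrite -eN !mulrA -exprSr -exprD.
  by rewrite addSn -addnS prednK ?subn_gt0 // subnKC 1?ltnW // mulrC.
move=> e; have : s ^+ 2 \is a GRing.unit by rewrite unitrX.
by rewrite e (negbTE (pi_multiple_nonunit _)).
Qed.

Lemma intr_dvd2 (m : int) k (y : Z2) : m%:~R = pi2 ^+ k * y -> (2 ^ k %| `|m|)%N.
Proof. by move/intr_dvd; rewrite dvdzE. Qed.

Lemma modn_dvd_sub (N r k : nat) :
  (r < k)%N -> (k %| `|N%:Z - r%:Z|)%N -> (N %% k == r)%N.
Proof.
move=> rk h; have : (k%:Z %| N%:Z - r%:Z)%Z by [].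
by rewrite -eqz_mod_dvd !modz_nat eqz_nat (modn_small rk).
Qed.

Section ResiduesMod8.
Variables (w : 'rV[Z2]_4) (r : 'I_4 -> nat) (y : 'I_4 -> Z2).
Hypothesis ew : forall i, w 0 i = (r i)%:R + 8%:R * y i.

Lemma nat_norm_approx : exists g, quat_norm w =
  (nat_norm (r 0) (r 1) (r 2%:R) (r 3%:R))%:R + 16%:R * g.
Proof.
pose sq i := (r i)%:R * y i + 4%:R * y i ^+ 2.
exists (sq 0 + sq 1 + sq 2%:R + sq 3%:R).
by rewrite /quat_norm !ew /nat_norm !natrD !natrX /sq; ring.
Qed.

Lemma nat_col_approx (i : 'I_3) : exists g, quat_rot w i 2%:R =
  (nat_col i (r 0) (r 1) (r 2%:R) (r 3%:R))%:R + 16%:R * g.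
Proof.
pose sq i := (r i)%:R * y i + 4%:R * y i ^+ 2.
pose pr i j := (r i)%:R * y j + y i * (r j)%:R + 8%:R * y i * y j.
rewrite mxE /= !ew /nat_col; case: i => [[|[|[|//]]] ?] /=.
- exists (pr 1 3%:R + pr 0 2%:R).
  by rewrite !(natrD, natrM) /pr; ring.
- exists (pr 2%:R 3%:R - pr 0 1 - (r 0)%:R * (r 1)%:R).
  by rewrite !(natrD, natrM) /pr; ring.
- exists (sq 0 - sq 1 - sq 2%:R + sq 3%:R - (r 1)%:R ^+ 2 - (r 2%:R)%:R ^+ 2).
  by rewrite !(natrD, natrM, natrX) /sq; ring.
Qed.

End ResiduesMod8.

Lemma square_class_cancel (F : fieldType) (c d x : F) :
  c != 0 -> x * d ^+ 2 = c ^+ 2 * (x * (d / c) ^+ 2).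
Proof. by move=> c0; field. Qed.

(** Modulo 4 the last column of an isometry of Z_2^3 has entries 0, 0 and a unit
    or 2, 2 and a unit, in some order. The norm tells which: the second kind
    occurs for norms with odd part 3 modulo 4, which are not 2^t d^2. *)
Lemma dyadic_quat_isom e (q : 'rV[padic prime_two]_4) (X : 'M[Z2]_3) (t : nat)
    (d : padic prime_two) :
  quat_norm q != 0 -> quat_isom e q = map_mx (@of_Zp prime_two) X ->
  quat_norm q = (2 ^ t)%:R * d ^+ 2 ->
  exists i z, X i 2%:R = 4%:R * z.
Proof.
move=> q0 eX eq; have [c [w [i0 [c0 ecw uw ew]]]] := primitive_quat_rot q0 eX.
have d0 : d != 0.
  by apply: contraNneq q0 => d0; rewrite eq d0 expr0n mulr0.
have [a [b b0 edc]] := padicP (d / c).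
have a0 : a != 0.
  apply: contraNneq d0 => a0; move: edc; rewrite a0 rmorph0 mul0r => /eqP.
  by rewrite mulf_eq0 invr_eq0 (negbTE c0) orbF.
have [m [s [us em]]] : exists m s, s \is a GRing.unit /\
    quat_norm w = pi2 ^+ m * s ^+ 2.
  apply: (dyadic_norm (t := t) a0 b0); apply: of_Zp_inj.
  rewrite [LHS]rmorphM [RHS]rmorphM /= !rmorphXn /= rmorph_nat.
  have ob : of_Zp b != 0 by rewrite of_Zp_eq0.
  have -> : of_Zp a = d / c * of_Zp b by rewrite edc divfK.
  rewrite exprMn [RHS]mulrA; congr (_ * _ ^+ 2); apply: (mulfI (expf_neq0 2 c0)).
  rewrite -(map_quat_norm (@of_Zp prime_two)) -quat_normZ -ecw eq.
  exact: square_class_cancel.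
have [v ev] := unit_sqr_mod8 us.
have /choice[r /choice[y hr]] i : exists r, exists y, (r < 8)%N /\
    w 0 i = r%:R + 8%:R * y.
  have [r [y [r8 e0]]] := nat_approx (w 0 i) 3; exists r, y; split=> //.
  by rewrite e0 pi2E; congr (_ + _ * _); rewrite -natrX.
have [g eN] := nat_norm_approx (fun i => (hr i).2).
have gcol := nat_col_approx (fun i => (hr i).2).
have r8 i := (hr i).1.
have chk := dyadic_checkP (r8 0) (r8 1) (r8 2%:R) (r8 3%:R).
rewrite /dyadic_check in chk; set N := nat_norm _ _ _ _ in eN chk.
set col := dvd_col _ _ _ _ in chk.
have some_odd : [|| odd (r 0), odd (r 1), odd (r 2%:R) | odd (r 3%:R)].
  have : odd (r i0).
    move: uw; rewrite (hr i0).2; apply: contraLR => er.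
    have -> : (r i0)%:R + 8%:R * y i0 = pi2 * ((r i0)./2%:R + 4%:R * y i0).
      rewrite -[r i0 in LHS]odd_double_half (negbTE er) add0n -mul2n natrM pi2E.
      by ring.
    exact: pi_multiple_nonunit.
  by case: (ord4_cases i0) => -> ->; rewrite ?orbT.
move: chk; rewrite some_odd /= => /and4P[N8 /implyP c4 /implyP c8 /implyP c16].
have fin k : m = k -> (k <= 2)%N -> col (4 * 2 ^ k)%N ->
    exists i z, X i 2%:R = 4%:R * z.
  move=> mk k2 /hasP[i]; rewrite mem_iota /= => i3 /dvdnP[h eh].
  exists (Ordinal i3); have [f ef] := gcol (Ordinal i3).
  have us2 : s ^+ 2 \is a GRing.unit by rewrite unitrX.
  exists ((s ^+ 2)^-1 * ((-1) ^+ e * (h%:R + (2 ^ (2 - k))%:R * f))).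
  have e16 : 16%:R = (4 * 2 ^ k)%:R * (2 ^ (2 - k))%:R :> Z2.
    by rewrite -natrM -mulnA -expnD subnKC.
  have p0 : (2 ^ k)%:R != 0 :> Z2.
    by have := expf_neq0 k (pi_neq0 prime_two); rewrite -natrX.
  rewrite mulrCA -[X _ _ in LHS](mulKr us2); congr (_ * _); apply: (mulfI p0).
  have se : (-1) ^+ e * (-1) ^+ e = 1 :> Z2 by rewrite -expr2 sqrr_sign.
  move: ef; rewrite ew mxE em eh e16 !natrM mk -natrX => ef.
  transitivity (((-1) ^+ e * (-1) ^+ e) *
      ((2 ^ k)%:R * (s ^+ 2 * X (Ordinal i3) 2%:R))); first by rewrite se mul1r.
  transitivity ((-1) ^+ e *
      ((-1) ^+ e * ((2 ^ k)%:R * s ^+ 2) * X (Ordinal i3) 2%:R)); first by ring.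
  by rewrite ef; ring.
move: em; rewrite eN ev.
case: m fin => [|[|[|m]]] fin em.
- apply: (fin 0%N) => //; apply: c4.
  have := @intr_dvd2 (N%:Z - 1) 3 (v - 2%:R * g).
  suff -> : (N%:Z - 1)%:~R = pi2 ^+ 3 * (v - 2%:R * g)
    by move/(_ erefl); apply: modn_dvd_sub.
  rewrite intrD -pmulrn pi2E -[N%:R](addrK (16%:R * g)) em; ring.
- apply: (fin 1%N) => //; apply: c8.
  have := @intr_dvd2 (N%:Z - 2) 4 (v - g).
  suff -> : (N%:Z - 2)%:~R = pi2 ^+ 4 * (v - g)
    by move/(_ erefl); apply: modn_dvd_sub.
  rewrite intrD -pmulrn pi2E -[N%:R](addrK (16%:R * g)) em pi2E; ring.
- apply: (fin 2%N) => //; apply: c16.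
  have := @intr_dvd2 (N%:Z - 4) 4 (2%:R * v - g).
  suff -> : (N%:Z - 4)%:~R = pi2 ^+ 4 * (2%:R * v - g).
   
    by move/(_ erefl); apply: modn_dvd_sub.
  rewrite intrD -pmulrn pi2E -[N%:R](addrK (16%:R * g)) em pi2E; ring.
- case/negP: N8; rewrite -/(dvdn 8 N).
  apply: (@intr_dvd2 N 3 (pi2 ^+ m * (1 + 8%:R * v) - 2%:R * g)).
  rewrite -pmulrn -[N%:R](addrK (16%:R * g)) em !exprS pi2E; ring.
Qed.

(** * Lattices with prescribed localisations *)

Lemma row_lattice_basis m n (F : 'M[int]_(n + m, n)) :
  exists (Y : 'M[int]_n) C C', F = C *m Y /\ Y = C' *m F.
Proof.
have [L uL [R uR [d _ eF]]] := int_Smith_normal_form F.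
set D := (\matrix_(i, j) _) in eF.
have eD : D = col_mx (usubmx D) 0.
  rewrite -{1}[D]vsubmxK; congr col_mx; apply/matrixP => i j; rewrite !mxE /=.
  by rewrite gtn_eqF ?mulr0n // ltn_addr.
exists (usubmx D *m R), (lsubmx L), (usubmx (invmx L)); split.
  rewrite eF mulmxA; congr (_ *m R).
  by rewrite eD -{1}[L]hsubmxK mul_row_col mulmx0 addr0 col_mxKu.
by rewrite eF -!mulmxA [RHS]mul_usub_mx mulKmx // mul_usub_mx.
Qed.

Lemma int_approx_mx m n (W : forall p, 'M[padic_int p]_(m, n)) (N : nat) :
  (0 < N)%N -> exists U : 'M[int]_(m, n), forall p, exists E,
    W p = map_mx intr U + N%:R *: E.
Proof.
move=> N0.
have /choice[r hr] (ij : 'I_m * 'I_n) : exists r : int, forall p, exists y,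
    W p ij.1 ij.2 = r%:~R + N%:R * y by apply: int_approx.
exists (\matrix_(i, j) r (i, j)) => p.
have /choice[y hy] ij : exists y, W p ij.1 ij.2 = (r ij)%:~R + N%:R * y by [].
by exists (\matrix_(i, j) y (i, j)); apply/matrixP => i j; rewrite !mxE -hy.
Qed.

(** There is a sublattice of Z^n whose localisations are the row spans of the
    A W'_p. It is spanned by the rows of A U and N, where the integral matrix U
    approximates all W'_p modulo N: the error A (U - W'_p) is in the span of N,
    and N is in the span of A W'_p since A divides N. *)
Lemma lattice_gluing n (A A' : 'M[int]_n) (N : nat)
    (W W' : forall p, 'M[padic_int p]_n) :
  (0 < N)%N -> A *m A' = N%:R%:M -> A' *m A = N%:R%:M ->
  (forall p, W p *m W' p = 1%:M) ->
  exists Y : 'M[int]_n, forall p, exists X X' : 'M[padic_int p]_n,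
    X *m X' = 1%:M /\ map_mx intr Y = X *m map_mx intr A *m W' p.
Proof.
move=> N0 AA' A'A WW'.
have [U hU] := int_approx_mx W' N0.
have [Y [C [C' [eF eY]]]] := @row_lattice_basis n n (col_mx (A *m U) N%:R%:M).
exists Y => p; have [E eW'] := hU p.
set a : 'M[padic_int p]_n := map_mx intr A.
set a' : 'M[padic_int p]_n := map_mx intr A'.
have aa' : a *m a' = N%:R%:M by rewrite -map_mxM AA' map_scalar_mx rmorph_nat.
have a'a : a' *m a = N%:R%:M by rewrite -map_mxM A'A map_scalar_mx rmorph_nat.
set F : 'M[padic_int p]_(n + n, n) := map_mx intr (col_mx (A *m U) N%:R%:M).
have eFm : F = col_mx (a *m map_mx intr U) N%:R%:M.
  by rewrite /F map_col_mx map_mxM map_scalar_mx rmorph_nat.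
pose Z := col_mx (1%:M - a *m E *m W p *m a') (W p *m a').
have FZ : F = Z *m (a *m W' p).
  rewrite eFm mul_col_mx; congr col_mx; last first.
    by rewrite mulmxA -[_ *m a' *m a]mulmxA a'a -scalemx1 -scalemxAr mulmx1
       -scalemxAl WW'.
  rewrite mulmxBl mul1mx mulmxA -[_ *m a' *m a]mulmxA a'a -[N%:R%:M]scalemx1.
  rewrite -scalemxAr mulmx1 -scalemxAl -[_ *m W p *m W' p]mulmxA WW' mulmx1.
  by rewrite [in a *m W' p]eW' mulmxDr -scalemxAr addrK.
have ZF : a *m W' p = row_mx 1%:M (a *m E) *m F.
  rewrite eFm mul_row_col mul1mx -[N%:R%:M]scalemx1 -scalemxAr mulmx1.
  by rewrite eW' mulmxDr -scalemxAr.
have eYp : map_mx intr Y = map_mx intr C' *m F by rewrite /F -map_mxM -eY.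
have eFp : F = map_mx intr C *m map_mx intr Y by rewrite /F -map_mxM -eF.
pose X := map_mx intr C' *m Z.
pose X' := row_mx 1%:M (a *m E) *m map_mx intr C.
have eX : map_mx intr Y = X *m a *m W' p.
  by rewrite eYp {1}FZ /X !mulmxA.
have X'X : X' *m X = 1%:M.
  have N0p : N%:R != 0 :> padic_int p.
    by apply: (@intr_neq0_Zp p N); rewrite eqz_nat -lt0n.
  have e1 : X' *m X *m (a *m W' p) = a *m W' p.
    by rewrite {2}ZF eFp eX /X' !mulmxA.
  move: (X' *m X) e1 => M /(congr1 (fun M' => M' *m (W p *m a'))).
  rewrite -!mulmxA [W' p *m (W p *m a')]mulmxA (mulmx1C (WW' p)) mul1mx aa'.
  rewrite mul_mx_scalar -[RHS]scalemx1 => /matrixP h.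
  by apply/matrixP => i j; have := h i j; rewrite !mxE => /(mulfI N0p).
by exists X, X'; rewrite (mulmx1C X'X).
Qed.

(** * The quadratic space of the form *)

Section Frame.
Variables (n : nat) (u v : int).
Hypothesis n_sum2 : n%:Z = u ^+ 2 + v ^+ 2.

Definition form_n := TernaryForm 1 1 (16 * n%:Z) 0 0 0.

(** The rows are orthogonal of value n for the form: they identify the space,
    with the form divided by n, with the pure quaternions. *)
Definition frame (F : fieldType) : 'M[F]_3 :=
  mx3 u%:~R v%:~R 0 (- v%:~R) u%:~R 0 0 0 4%:R^-1.

Definition frame_inv (F : fieldType) : 'M[F]_3 :=
  mx3 (u%:~R / n%:R) (- v%:~R / n%:R) 0 (v%:~R / n%:R) (u%:~R / n%:R) 0
      0 0 4%:R.

Lemma map_frame_inv (F F' : fieldType) (k : {rmorphism F -> F'}) :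
  map_mx k (frame_inv F) = frame_inv F'.
Proof.
by rewrite map_mx3 !fmorph_div !rmorphN !rmorph_int rmorph0 !rmorph_nat.
Qed.

Variable F : fieldType.
Hypotheses (n_neq0 : n%:R != 0 :> F) (F2_neq0 : 2%:R != 0 :> F).
Implicit Types x w : 'rV[F]_3.

Let nE : n%:R = u%:~R ^+ 2 + v%:~R ^+ 2 :> F.
Proof. by rewrite -!rmorphXn -rmorphD -n_sum2. Qed.

Let four_neq0 : 4%:R != 0 :> F.
Proof. by rewrite (natrM _ 2 2) mulf_neq0. Qed.

Lemma frameK : frame F *m frame_inv F = 1%:M.
Proof.
rewrite mulmx3 scalar_mx3.
by congr mx3; rewrite ?(mul0r, mulr0, addr0, add0r) //; move: n_neq0;
  rewrite nE => n0; field.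
Qed.

Lemma qform_dot x :
  qform form_n x = n%:R * dot (x *m frame_inv F) (x *m frame_inv F).
Proof.
rewrite [in RHS](row3_eta x) mulrow3 /qform /form_value /dot !row3E /= rmorphM /=.
rewrite -pmulrn.
by move: n_neq0; rewrite nE => ?; field.
Qed.

Lemma polar_dot x w : polar form_n x w =
  2%:R * (n%:R * dot (x *m frame_inv F) (w *m frame_inv F)).
Proof. by rewrite /polar !qform_dot mulmxDl /dot !mxE; ring. Qed.

Lemma reflection_frame x w : qform form_n w != 0 ->
  reflection form_n w x *m frame_inv F =
  x *m frame_inv F *m quat_isom 1 (pure_quat (w *m frame_inv F)).
Proof.
rewrite qform_dot mulf_eq0 negb_or => /andP[_ w0].
rewrite reflectE // /reflection mulmxBl -scalemxAl polar_dot qform_dot.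
by congr (_ - _ *: _); field; apply/andP.
Qed.

Lemma reflections_quat (ws : seq 'rV[F]_3) :
  (forall w, w \in ws -> qform form_n w != 0) ->
  exists q, [/\ quat_norm q != 0,
    \prod_(w <- ws) qform form_n w = n%:R ^+ size ws * quat_norm q &
    forall x, foldr (@reflection form_n F) x ws *m frame_inv F =
      x *m frame_inv F *m quat_isom (size ws) q].
Proof.
elim: ws => [_|w ws IH ws0].
  exists (quat_one F); rewrite quat_norm_one oner_eq0 big_nil mul1r.
  by split=> // x /=; rewrite quat_isom_one mulmx1.
have [|q [q0 pq fq]] := IH.
  by move=> w' w'ws; apply: ws0; rewrite inE w'ws orbT.
have w0 : qform form_n w != 0 by apply: ws0; rewrite mem_head.
pose w' := w *m frame_inv F.
have ew : qform form_n w = n%:R * quat_norm (pure_quat w').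
  by rewrite qform_dot quat_norm_pure.
exists (quat_mul q (pure_quat w')); rewrite quat_normM; split.
- by rewrite mulf_neq0 //; move: w0; rewrite ew mulf_eq0 negb_or => /andP[].
- by rewrite big_cons pq ew /= exprS; ring.
- by move=> x /=; rewrite reflection_frame // fq -mulmxA quat_isomM addn1.
Qed.

(** The product of the values of the form at the axes of the reflections is
    n^m N(q), where m is their number; m is even as the determinant is 1, so
    that N(q) is a square along with the product. *)
Lemma spinor_kernel_quat (S : 'M[F]_3) : spinor_kernel form_n S ->
  exists q d, [/\ quat_norm q != 0, quat_norm q = d ^+ 2 &
    S *m frame_inv F = frame_inv F *m quat_isom 0 q].
Proof.
case=> -[_ detS] [ws [ws0 eS [c c0 ec]]].
have [q [q0 pq fq]] := reflections_quat ws0.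
have eSq : S *m frame_inv F = frame_inv F *m quat_isom (size ws) q.
  apply/row_matrixP => i; rewrite -[frame_inv F in RHS]mul1mx !row_mul.
  by rewrite -fq -eS; congr (_ *m _); rewrite -row_mul mul1mx.
have sgn : (-1) ^+ size ws = 1 :> F.
  rewrite -(det_quat_isom (size ws) q0); apply/esym.
  have := congr1 determinant eSq; rewrite !det_mulmx detS mul1r => e.
  have dA : \det (frame_inv F) != 0.
    apply: contraTneq (oner_neq0 F) => d0.
    by rewrite -(det1 F 3) -frameK det_mulmx d0 mulr0 eqxx.
  by apply: (mulfI dA); rewrite -e mulr1.
have even : ~~ odd (size ws).
  apply/negP => od; move: sgn; rewrite -signr_odd od expr1 => e1.
  by move: F2_neq0; rewrite -[2%:R]/(1 + 1) -{1}e1 addNr eqxx.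
have e0 : quat_isom (size ws) q = quat_isom 0 q by rewrite /quat_isom sgn.
exists q, (c / n%:R ^+ (size ws)./2); split; rewrite -?e0 //.
rewrite mul1r in ec; apply: (mulfI (expf_neq0 (size ws) n_neq0)).
rewrite -pq ec expr_div_n -exprM muln2 even_halfK //.
by rewrite mulrC divfK // expf_neq0.
Qed.

End Frame.

(** * Local to global *)

Lemma even_odd_logn (r : nat) : (0 < r)%N ->
  (forall p, prime p -> p != 2 -> ~~ odd (logn p r)) ->
  exists t s, r = (2 ^ t * s ^ 2)%N.
Proof.
elim/ltn_ind: r => r IH r0 ev.
have [r1|r1] := leqP r 1; first by exists 0%N, 1%N; apply/eqP; rewrite eqn_leq r1.
have qp := pdiv_prime r1; set q := pdiv r in qp.
have qr : (q %| r)%N := pdiv_dvd r.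
have [q2|q2] := eqVneq q 2.
  have d2 : (2 %| r)%N by move: qr; rewrite q2.
  have e : r = (2 * (r %/ 2))%N by rewrite mulnC divnK.
  have r'0 : (0 < r %/ 2)%N by rewrite divn_gt0.
  have lt : (r %/ 2 < r)%N by rewrite ltn_Pdiv.
  have [|t [s es]] := IH _ lt r'0.
    move=> p pp p2.
    by have := ev p pp p2; rewrite {1}e lognM // logn_prime // (negbTE p2).
  by exists t.+1, s; rewrite e es [(2 ^ t.+1)%N]expnS mulnA.
have q2r : (q ^ 2 %| r)%N.
  rewrite pfactor_dvdn //; have := ev q qp q2.
  have : (0 < logn q r)%N by rewrite logn_gt0 mem_primes qp r0.
  by case: (logn q r) => [|[|k]].
have e : r = (q ^ 2 * (r %/ q ^ 2))%N by rewrite mulnC divnK.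
have qq0 : (0 < q ^ 2)%N by rewrite expn_gt0 prime_gt0.
have r'0 : (0 < r %/ q ^ 2)%N by rewrite divn_gt0 // dvdn_leq.
have lt : (r %/ q ^ 2 < r)%N.
  by rewrite ltn_Pdiv // -{1}[1%N](exp1n 2) ltn_exp2r // prime_gt1.
have [|t [s es]] := IH _ lt r'0.
  move=> p pp p2.
  by have := ev p pp p2; rewrite {1}e lognM // lognX oddD oddM.
by exists t, (q * s)%N; rewrite e es expnMn; lia.
Qed.

Lemma map_intr_inj m n :
  injective (map_mx intr : 'M[int]_(m, n) -> 'M[rat]_(m, n)).
Proof.
move=> X Y /matrixP e; apply/matrixP => i j; apply: (@intr_inj rat).
by have := e i j; rewrite !mxE.
Qed.

(** The Gram matrix of Y is that of X at every prime, hence integral of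
    determinant 1, and so equivalent to the identity. *)
Section OrthonormalBasis.
Variable Y : 'M[rat]_3.
Hypothesis locY : forall p, exists (X X' : 'M[padic_int p]_3) q,
  [/\ X *m X' = 1%:M, quat_norm q != 0 &
      map_mx (of_Q p) Y = map_mx (@of_Zp p) X *m quat_isom 0 q].

Lemma orthonormal_basis : exists2 V : 'M[int]_3, V \in unitmx &
  let T := map_mx intr V *m Y in T *m T^T = 1%:M.
Proof.
have loc p : exists X X' : 'M[padic_int p]_3, X *m X' = 1%:M /\
    map_mx (of_Q p) (Y *m Y^T) = map_mx (@of_Zp p) (X *m X^T).
  have [X [X' [q [XX' q0 eY]]]] := locY p; exists X, X'; split=> //.
  rewrite !map_mxM -!map_trmx eY trmx_mul mulmxA -[_ *m _ *m (quat_isom 0 q)^T]mulmxA.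
  by rewrite tr_quat_isom (quat_isomV 0 q0) mulmx1.
have [|P eP] := @integral_everywhere_mx _ _ (Y *m Y^T).
  by move=> p; have [X [_ [_ e]]] := loc p; exists (X *m X^T).
have sP : P^T = P.
  by apply: map_intr_inj; rewrite -map_trmx -eP trmx_mul trmxK.
have detP : (\det P)%:~R = \det Y ^+ 2 :> rat.
  by rewrite -det_map_mx -eP det_mulmx det_tr.
have absP : `|\det P|%N = 1%N.
  apply: unit_everywhere => p; have [X [X' [XX' e]]] := loc p.
  exists (\det X' ^+ 2).
  have -> : (\det P)%:~R = \det X ^+ 2 :> padic_int p.
    apply: of_Zp_inj; rewrite rmorph_int -(rmorph_int (of_Q p)).
    rewrite -det_map_mx -eP -det_map_mx e det_map_mx det_mulmx det_tr.
    by rewrite -expr2.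
  by rewrite -exprMn -det_mulmx XX' det1 expr1n.
have detP1 : \det P = 1.
  have : 0 <= (\det P)%:~R :> rat by rewrite detP sqr_ge0.
  by rewrite ler0z => /gez0_abs <-; rewrite absP.
have Y0 : \det Y != 0.
  by apply/eqP => d0; move/eqP: detP; rewrite d0 detP1 expr0n /= oner_eq0.
have [|V uV eV] := unimodular_form sP _ detP1.
  move=> x x0; rewrite -(ltr0z rat).
  have -> : ((x *m P *m x^T) 0 0)%:~R =
      dot (map_mx intr x *m Y) (map_mx intr x *m Y) :> rat.
    rewrite dot_mx trmx_mul mulmxA -[_ *m Y *m _]mulmxA eP map_trmx.
    by rewrite -!map_mxM [RHS]mxE.
  apply: dot_gt0; apply: contraNneq x0 => xY.
  have uY : Y \in unitmx by rewrite unitmxE unitfE.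
  apply/eqP/map_intr_inj.
  by rewrite -[LHS]mulmx1 -(mulmxV uY) mulmxA xY mul0mx map_mx0.
exists (invmx V); first by rewrite unitmx_inv.
rewrite /= trmx_mul mulmxA -[_ *m Y *m _]mulmxA eP map_trmx -!map_mxM eV.
by rewrite mulmxA mulVmx // mul1mx trmx_inv mulmxV ?unitmx_tr // map_mx1.
Qed.

End OrthonormalBasis.

Lemma square_class_solve (F : fieldType) (N D h c w : F) : D != 0 -> h != 0 ->
  N / D ^+ 2 * h ^+ 2 = c ^+ 2 * w -> N = (c * D / h) ^+ 2 * w.
Proof.
move=> D0 h0 e; transitivity ((N / D ^+ 2 * h ^+ 2) * (D / h) ^+ 2).
  by field; apply/andP.
by rewrite e; field.
Qed.

Lemma square_class_mul (F : fieldType) (t s D d : F) :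
  t * s ^+ 2 / D ^+ 2 * d ^+ 2 = t * (s * d / D) ^+ 2.
Proof. by rewrite !exprMn exprVn; set D' := (D ^+ 2)^-1; ring. Qed.

(** T is the isometry of a rational quaternion b, and X that of b times the
    conjugate of q, whose norm is N(b) up to squares. Integrality at the odd
    primes makes all odd valuations of N(b) even, so that at 2 the norm is a
    power of 2 up to squares. *)
Lemma dyadic_column (T : 'M[rat]_3) : T *m T^T = 1%:M ->
  (forall p, exists (X : 'M[padic_int p]_3) q d,
    [/\ quat_norm q != 0, quat_norm q = d ^+ 2 &
      map_mx (of_Q p) T = map_mx (@of_Zp p) X *m quat_isom 0 q]) ->
  forall (X : 'M[padic_int prime_two]_3) q d,
    quat_norm q != 0 -> quat_norm q = d ^+ 2 ->
    map_mx (of_Q prime_two) T = map_mx (@of_Zp prime_two) X *m quat_isom 0 q ->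
    exists i z, X i 2%:R = 4%:R * z.
Proof.
move=> TT locT X q d q0 qd eX.
have [e [b [b0 eT]]] := orthogonal_quat TT.
have isomE p (X0 : 'M[padic_int p]_3) r : quat_norm r != 0 ->
    map_mx (of_Q p) T = map_mx (@of_Zp p) X0 *m quat_isom 0 r ->
    quat_isom e (quat_mul (map_mx (of_Q p) b) (quat_conj r)) =
    map_mx (@of_Zp p) X0.
  move=> r0 eX0; rewrite -[e]addn0 -quat_isomM.
  have -> : quat_isom e (map_mx (of_Q p) b) = map_mx (of_Q p) T.
    rewrite eT /quat_isom map_mxZ map_quat_rot map_quat_norm.
    by rewrite fmorph_div rmorph_sign.
  by rewrite eX0 -mulmxA quat_isomV // mulmx1.
have normE p r s : quat_norm r = s ^+ 2 ->
    quat_norm (quat_mul (map_mx (of_Q p) b) (quat_conj r)) =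
    of_Q p (quat_norm b) * s ^+ 2.
  by move=> er; rewrite quat_normM map_quat_norm quat_norm_conj er.
have norm_neq0 p (r : 'rV[padic p]_4) : quat_norm r != 0 ->
    quat_norm (quat_mul (map_mx (of_Q p) b) (quat_conj r)) != 0.
  move=> r0; rewrite quat_normM map_quat_norm quat_norm_conj.
  by apply: mulf_neq0; [rewrite fmorph_eq0; exact: b0 | exact: r0].
have bgt0 : 0 < quat_norm b.
  by rewrite lt0r b0 /quat_norm !addr_ge0 // sqr_ge0.
(* N(b) is the natural number N up to the square of its denominator D. *)
set D := denq (quat_norm b).
pose N := absz (numq (quat_norm b) * D).
have numgt0 : 0 < numq (quat_norm b) by rewrite numq_gt0.
have Ngt0 : (0 < N)%N by rewrite absz_gt0 mulf_neq0 // ?denq_neq0 // gt_eqF.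
have eN : quat_norm b = N%:R / D%:~R ^+ 2.
  rewrite pmulrn gez0_abs ?mulr_ge0 // ?ltW ?denq_gt0 // rmorphM /= -/D.
  have D0 : D%:~R != 0 :> rat by rewrite intr_eq0 denq_neq0.
  by rewrite -[LHS]divq_num_den -/D; field.
have DK p : D%:~R != 0 :> padic p by rewrite intr_neq0_Qp // denq_neq0.
have NK p : of_Q p (quat_norm b) = N%:R / D%:~R ^+ 2.
  by rewrite eN fmorph_div rmorphXn /= rmorph_nat rmorph_int.
have [p pp p2|t [s eNs]] := @even_odd_logn N Ngt0.
  pose P : prime_number := exist _ p pp.
  have [X0 [r [h [r0 rh eX0]]]] := locT P.
  have [c [w [uw ew]]] :=
    @odd_quat_norm P e _ _ p2 (norm_neq0 _ _ r0) (isomE _ _ _ r0 eX0).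
  rewrite (normE _ _ _ rh) NK in ew.
  have h0 : h != 0 by move: r0; rewrite rh expf_eq0.
  exact: (even_logn_of_square Ngt0 uw (square_class_solve (DK P) h0 ew)).
apply: (@dyadic_quat_isom e _ X t (s%:R * d / D%:~R) (norm_neq0 _ _ q0)
  (isomE _ _ _ q0 eX)).
rewrite (normE _ _ _ qd) NK eNs natrM (natrX _ s 2).
exact: square_class_mul.
Qed.

Lemma scaled_frame_cancel (F : fieldType) (k : F) (X A A' Q : 'M[F]_3) :
  k != 0 -> A *m A' = 1%:M ->
  k^-1 *: (X *m ((k *: A) *m (A' *m Q))) = X *m Q.
Proof.
move=> k0 AA'; rewrite -scalemxAl -scalemxAr scalerA mulVf // scale1r.
by rewrite [A *m _]mulmxA AA' mul1mx.
Qed.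

(** * Localisations and bases *)

Section Localization.
Variable p : prime_number.

Lemma map_ratrE m k (X : 'M[rat]_(m, k)) :
  map_mx ratr X = map_mx (of_Q p) X.
Proof. by []. Qed.

Lemma mem_localization (M : set 'rV[rat]_3) x :
  M x -> localization p M (map_mx (of_Q p) x).
Proof.
move=> Mx; exists 1%N, (const_mx 1), x; split.
  by move=> i; rewrite (_ : row i x = x) //; apply/rowP => j; rewrite !mxE ord1.
rewrite map_ratrE; apply/rowP => j; rewrite !mxE big_ord1 !mxE.
by rewrite (rmorph1 (@of_Zp p)) mul1r.
Qed.

Lemma localization_Zspan (B : 'M[rat]_3) y : localization p (Zspan B) y ->
  exists c, y = map_mx (@of_Zp p) c *m map_mx (of_Q p) B.
Proof.
case=> m [c [X [BX ->]]].
have /choice[a ha] i : exists a, row i X = map_mx intr a *m B.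
  by have [a _ <-] := BX i; exists a.
pose A : 'M[int]_(m, 3) := \matrix_(i, j) a i 0 j.
have -> : X = map_mx intr A *m B.
  apply/row_matrixP => i; rewrite ha row_mul; congr (_ *m _).
  by apply/rowP => j; rewrite !mxE.
exists (c *m map_mx intr A); rewrite map_ratrE map_mxM /= mulmxA map_mxM /=.
by apply: (congr1 (fun M => _ *m M *m _)); apply: map_of_Q_intr.
Qed.

Lemma row_Zspan (B : 'M[rat]_3) i : Zspan B (row i B).
Proof.
exists (delta_mx 0 i) => //; rewrite rowE; congr (_ *m _).
by apply/rowP => j; rewrite !mxE; case: (_ && _).
Qed.

(** Each of the two spanning sets is integral over the other, which makes the
    transition matrix W invertible over Z_p. *)
Lemma localization_basis (B : 'M[rat]_3) (R : 'M[padic p]_3) : B \in unitmx ->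
  localization p (Zspan B) =
    [set v *m R | v in localization p standard_lattice]%classic ->
  exists W W' : 'M[padic_int p]_3,
    W *m W' = 1%:M /\ map_mx (of_Q p) B = map_mx (@of_Zp p) W *m R.
Proof.
move=> uB eL.
have /choice[w hw] i : exists w : 'rV_3,
    row i (map_mx (of_Q p) B) = map_mx (@of_Zp p) w *m R.
  have : localization p (Zspan B) (row i (map_mx (of_Q p) B)).
    by rewrite -map_row; apply/mem_localization/row_Zspan.
  rewrite eL => -[v /localization_Zspan[w ->] <-]; exists w.
  by rewrite map_mx1 mulmx1.
have /choice[w' hw'] i : exists w' : 'rV_3,
    row i R = map_mx (@of_Zp p) w' *m map_mx (of_Q p) B.
  apply: localization_Zspan; rewrite eL.
  exists (row i 1%:M); last by rewrite -row_mul mul1mx.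
  rewrite -(map_mx1 (of_Q p)) -map_row.
  exact/mem_localization/row_Zspan.
pose W := \matrix_(i, j) w i 0 j; pose W' := \matrix_(i, j) w' i 0 j.
have eW : map_mx (of_Q p) B = map_mx (@of_Zp p) W *m R.
  apply/row_matrixP => i; rewrite hw row_mul; congr (_ *m _).
  by apply/rowP => j; rewrite !mxE.
have eW' : R = map_mx (@of_Zp p) W' *m map_mx (of_Q p) B.
  apply/row_matrixP => i; rewrite hw' row_mul; congr (_ *m _).
  by apply/rowP => j; rewrite !mxE.
exists W, W'; split=> //; apply: (@map_of_Zp_inj p); rewrite map_mxM map_mx1 /=.
have uBK : map_mx (of_Q p) B \in unitmx by rewrite map_unitmx.
apply: (can_inj (mulmxK uBK)).
by rewrite -mulmxA -eW' -eW mul1mx.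
Qed.

End Localization.

(** * Representing n by a lattice in the spinor genus *)

Section SpinorGenus.
Variables (n : nat) (u v : int) (B : 'M[rat]_3).
Hypotheses (n_gt0 : (0 < n)%N) (n_sum2 : n%:Z = u ^+ 2 + v ^+ 2).
Hypothesis spn : forall p, exists S (W W' : 'M[padic_int p]_3),
  [/\ spinor_kernel (form_n n) S, W *m W' = 1%:M &
      map_mx (of_Q p) B = map_mx (@of_Zp p) W *m S].

Let nQ : n%:R != 0 :> rat. Proof. by rewrite pnatr_eq0 -lt0n. Qed.

Let nK p : n%:R != 0 :> padic p.
Proof. by apply: (@intr_neq0_Qp p n); rewrite eqz_nat -lt0n. Qed.

Let twoK p : 2%:R != 0 :> padic p.
Proof. exact: (@intr_neq0_Qp p 2). Qed.

(** A lattice with localisations (Z_p i + Z_p j + Z_p k) S_p, where i, j, k are the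
    rows of the frame. The rows of Y are the coordinates of its basis in the
    basis B; the last clause, with four times the frame as the middle factor,
    compares it locally with the lattice spanned by B. *)
Let unimodular_lattice : exists (Y : 'M[rat]_3),
  (forall p, exists (X X' : 'M[padic_int p]_3) W' q d,
    [/\ X *m X' = 1%:M, quat_norm q != 0, quat_norm q = d ^+ 2,
      map_mx (of_Q p) (Y *m B *m frame_inv n u v rat)
        = map_mx (@of_Zp p) X *m quat_isom 0 q &
      4%:R *: map_mx (of_Q p) Y = map_mx (@of_Zp p)
        (X *m mx3 (4%:R * u%:~R) (4%:R * v%:~R) 0
         (- (4%:R * v%:~R)) (4%:R * u%:~R) 0 0 0 1 *m W')]).
Proof.
(* A is four times the frame, and A' is 4 n times its inverse. *)
pose A : 'M[int]_3 :=
  mx3 (4%:R * u) (4%:R * v) 0 (- (4%:R * v)) (4%:R * u) 0 0 0 1.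
pose A' : 'M[int]_3 := mx3 u (- v) 0 v u 0 0 0 (4 * n)%:Z.
pose S p := projT1 (cid (spn p)).
pose W p := projT1 (cid (projT2 (cid (spn p)))).
pose W' p := projT1 (cid (projT2 (cid (projT2 (cid (spn p)))))).
have H p : [/\ spinor_kernel (form_n n) (S p), W p *m W' p = 1%:M &
      map_mx (of_Q p) B = map_mx (@of_Zp p) (W p) *m S p].
  exact: (projT2 (cid (projT2 (cid (projT2 (cid (spn p))))))).
have n4 : (0 < 4 * n)%N by rewrite muln_gt0.
have e4n : (4 * n)%N%:R = 4%:R * (u ^+ 2 + v ^+ 2) :> int.
  by rewrite natrM -n_sum2 [n%:R]natz.
have AA' : A *m A' = (4 * n)%N%:R%:M.
  rewrite mulmx3 scalar_mx3 e4n -[(4 * n)%:Z]natz e4n.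
  by congr mx3; ring.
have A'A : A' *m A = (4 * n)%N%:R%:M.
  rewrite mulmx3 scalar_mx3 e4n -[(4 * n)%:Z]natz e4n.
  by congr mx3; ring.
have [|Y hY] := lattice_gluing n4 AA' A'A (W := W) (W' := W').
  by move=> p; case: (H p).
exists (4%:R^-1 *: map_mx intr Y) => p.
have [X [X' [XX' eY]]] := hY p; have [kS WW' eB] := H p.
have [q [d [q0 qd eS]]] := spinor_kernel_quat n_sum2 (nK p) (twoK p) kS.
have c4 : of_Q p 4%:R^-1 = 4%:R^-1 by rewrite fmorphV rmorph_nat.
have f4 : 4%:R != 0 :> padic p by exact: (@intr_neq0_Qp p 4).
have mY : map_mx (of_Q p) (4%:R^-1 *: map_mx intr Y) =
    4%:R^-1 *: map_mx (@of_Zp p) (map_mx intr Y).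
  by rewrite map_mxZ /= c4 map_of_Q_intr.
have mA : map_mx intr A = mx3 (4%:R * u%:~R) (4%:R * v%:~R) 0
     (- (4%:R * v%:~R)) (4%:R * u%:~R) 0 0 0 1 :> 'M[padic_int p]_3.
  by rewrite map_mx3 !(rmorphN, rmorphM, rmorph0, rmorph1, rmorph_nat).
have mAK : map_mx (@of_Zp p) (map_mx intr A) = 4%:R *: frame u v (padic p).
  rewrite mA map_mx3 scalemx3 mulfV //.
  by rewrite !(rmorphN, rmorphM, rmorph0, rmorph1, rmorph_nat, rmorph_int)
    mulr0 mulrN.
exists X, X', (W' p), q, d; split=> //; last first.
  by rewrite mY scalerA mulfV // scale1r eY mA.
rewrite !map_mxM mY eY eB /= map_frame_inv -!scalemxAl !map_mxM /=.
rewrite -!mulmxA [map_mx _ (W' p) *m _]mulmxA -map_mxM (mulmx1C WW') map_mx1.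
rewrite mul1mx eS [map_mx _ (map_mx intr A)]mAK.
exact: scaled_frame_cancel f4 (frameK n_sum2 (nK p) (twoK p)).
Qed.

(** The vectors of the orthonormal basis have value n. At the odd primes they
    are in the span of B, the denominators of the frame being powers of 2; at 2
    this holds for one whose last coordinate in the frame is divisible by 4. *)
Lemma represented_in_lattice :
  exists c : 'rV[int]_3, qform (form_n n) (map_mx intr c *m B) = n%:R.
Proof.
have [Y locY] := unimodular_lattice.
set Yh := Y *m B *m frame_inv n u v rat in locY.
have [|V uV /= TT] := @orthonormal_basis Yh.
  by move=> p; have [X [X' [W' [q [d []]]]]] := locY p; exists X, X', q.
set T := map_mx intr V *m Yh in TT.
have locT p (X : 'M[padic_int p]_3) q :
    map_mx (of_Q p) Yh = map_mx (@of_Zp p) X *m quat_isom 0 q ->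
    map_mx (of_Q p) T = map_mx (@of_Zp p) (map_mx intr V *m X) *m quat_isom 0 q.
  move=> eY; rewrite /T [LHS]map_mxM eY [X in _ = X *m _]map_mxM mulmxA.
  by apply: (congr1 (fun M => M *m _ *m _)); apply: map_of_Q_intr.
have [X [X' [W' [q [d [_ q0 qd eY e4]]]]]] := locY prime_two.
have [|i [z ez]] := dyadic_column TT _ q0 qd (locT _ _ _ eY).
  move=> p; have [Xp [_ [_ [r [h [_ r0 rh eYp _]]]]]] := locY p.
  by exists (map_mx intr V *m Xp), r, h; split=> //; apply: locT.
pose rho := row i (map_mx intr V *m Y).
have four p (Xp : 'M[padic_int p]_3) A (Wp : 'M_3) :
    4%:R *: map_mx (of_Q p) Y = map_mx (@of_Zp p) (Xp *m A *m Wp) ->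
    4%:R *: map_mx (of_Q p) rho =
      map_mx (@of_Zp p) (row i (map_mx intr V *m Xp) *m A *m Wp).
  move=> e; rewrite map_row map_mxM -linearZ /= scalemxAr e -!row_mul map_row.
  rewrite -!mulmxA !map_mxM /=; congr (row _ (_ *m _)).
  exact: map_of_Q_intr.
have f4 p : 4%:R != 0 :> padic p by exact: (@intr_neq0_Qp p 4).
have div4 p M (Z : 'rV[padic_int p]_3) : M = 4%:R *: Z ->
    4%:R *: map_mx (of_Q p) rho = map_mx (@of_Zp p) M ->
    map_mx (of_Q p) rho = map_mx (@of_Zp p) Z.
  by move=> -> e; apply: (scalerI (f4 p)); rewrite e map_mxZ rmorph_nat.
have [|c ec] := @integral_everywhere_mx _ _ rho.
  move=> p; have [p2|p2] := eqVneq p prime_two.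
    move: p2 => -> {p}; have {}e4 := four _ _ _ _ e4.
    set r := row i _ in e4.
    have r2 : r 0 2%:R = 4%:R * z by rewrite mxE.
    exists (row3 (r 0 0 * u%:~R - r 0 1 * v%:~R) (r 0 0 * v%:~R + r 0 1 * u%:~R) z
      *m W').
    apply: div4 e4; rewrite scalemxAl; congr (_ *m _).
    rewrite [r in LHS]row3_eta mulrow3 r2.
    by apply/rowP => -[[|[|[|//]]] ?]; rewrite !mxE /=; ring.
  have [Xp [_ [Wp [_ [_ [_ _ _ _ /four e4p]]]]]] := locY p.
  have u4 : (4%:R : padic_int p) \is a GRing.unit by apply: four_unit.
  eexists; apply: div4 e4p; rewrite -[LHS]scale1r -[X in X *: _](mulrV u4).
  by rewrite -scalerA.
exists c; rewrite -ec (qform_dot n_sum2 nQ) ?pnatr_eq0 //.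
rewrite /rho -row_mul -row_mul -!mulmxA [Y *m (B *m _)]mulmxA -/Yh -/T.
by rewrite dot_mx -row_mul tr_row colE mulmxA -colE TT !mxE eqxx mulr1.
Qed.

End SpinorGenus.

Theorem theorem5p1 (n : nat) (n_gt0 : (0 < n)%N) (n_even : ~~ odd n)
    (n_squarefree : squarefree n)
    (n_sum2 : exists u v : int, n%:Z = u ^+ 2 + v ^+ 2)
    (g : ternary_form) (g_posdef : positive_definite g)
    (g_primitive : primitive_form g)
    (g_spn : in_spinor_genus (TernaryForm 1 1 (16 * n%:Z) 0 0 0) g) :
  integrally_represents g n%:Z.
Proof.
have [u [v uv]] := n_sum2.
have [M [h [_ [s os locM] [B [uB eM] hB] [U uU gU]]]] := g_spn.
have [us fs] := os.
(* Moving M by s^-1 leaves only the local rotations. *)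
pose B0 := B *m invmx s.
have [p|c ec] := @represented_in_lattice n u v B0 n_gt0 uv.
  have [S kS eL] := locM p.
  have [W [W' [WW' eB]]] := localization_basis uB (etrans (congr1 _ (esym eM)) eL).
  exists S, W, W'; split=> //.
  rewrite map_mxM eB -!mulmxA map_ratrE -map_mxM mulmxV // map_mx1 mulmx1.
  by [].
exists ((c *m invmx U) 0 0), ((c *m invmx U) 0 1), ((c *m invmx U) 0 2%:R).
rewrite -/(qform g (c *m invmx U)) gU mulmxKV //.
apply: (@intr_inj rat); rewrite hB -[B](mulmxKV us) mulmxA fs.
by rewrite -pmulrn -ec.
Qed.
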